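(* The functors $\mathbf E:\mathbf{PA}\to\mathbf{RSBS}$ and $\mathbf P:\mathbf{RSBS}\to\mathbf{PA}$ satisfy $$\mathbf P\circ\mathbf E=\mathrm{id}_{\mathbf{PA}}\qquad\text{and}\qquad\mathbf E\circ\mathbf P\cong\mathrm{id}_{\mathbf{RSBS}}.$$ Consequently, the functors $\mathbf P$ and $\mathbf E$ furnish an equivalence of the categories $\mathbf{PA}$ and $\mathbf{RSBS}$. (Here $\cong$ denotes natural isomorphism of functors.)
   Context: Maps (other than functors) are written to the right of their arguments and composed left to right; for functors, $(\mathbf P\circ\mathbf E)(P)=\mathbf P(\mathbf E(P))$. PROJECTION ALGEBRAS. A projection algebra is a set $P$ with unary operations $\theta_p:P\to P$ ($p\in P$) such that for all $p,q\in P$: $p\theta_p=p$; $\theta_p\theta_p=\theta_p$; $p\theta_q\theta_p=q\theta_p$; $\theta_p\theta_q\theta_p=\theta_{q\theta_p}$; $\theta_p\theta_q\theta_p\theta_q=\theta_p\theta_q$. $\mathbf{PA}$ is the category of projection algebras with morphisms the maps $\phi:P\to P'$ satisfying $(p\theta_q)\phi=(p\phi)\theta_{q\phi}$. On $P$ define $p\leq_{\mathscr F}q$ iff $p=q\theta_p$; $p\mathrel{\mathscr F}q$ iff $p\leq_{\mathscr F}q$ and $q\leq_{\mathscr F}p$. THE SEMIGROUP $\mathsf{PG}(P)$. A regular $*$-semigroup is a semigroup with a unary operation satisfying $(a^* )^*=a=aa^*a$, $(ab)^*=b^*a^*$. A $P$-path is a tuple $(p_1,\ldots,p_k)$ ($k\geq1$)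 with $p_1\mathrel{\mathscr F}\cdots\mathrel{\mathscr F}p_k$, regarded as a morphism $p_1\to p_k$; the path category $\mathscr P(P)$ consists of all $P$-paths under $(p_1,\ldots,p_k)\circ(p_k,\ldots,p_l)=(p_1,\ldots,p_k,\ldots,p_l)$. A pair $(e,f)\in P\times P$ is $p$-linked ($p\in P$) if $f=e\theta_p\theta_f$ and $e=f\theta_p\theta_e$. Let $\equiv$ be the (category) congruence on $\mathscr P(P)$ generated by all $((p,p),(p))$ with $p\in P$, all $((p,q,p),(p))$ with $p\mathrel{\mathscr F}q$, and all $((e,e\theta_p,f),(e,f\theta_p,f))$ with $p\in P$ and $(e,f)$ $p$-linked. The class of $(p_1,\ldots,p_k)$ is $[\![p_1,\ldots,p_k]\!]$. The regular $*$-semigroup $\mathsf{PG}(P)$ consists of all classes, with $[\![p_1,\ldots,p_k]\!]^*=[\![p_k,\ldots,p_1]\!]$ and $[\![p_1,\ldots,p_k]\!]\bullet[\![q_1,\ldots,q_l]\!]=[\![p_1',\ldots,p_k',q_1',\ldots,q_l']\!]$, where, with $p'=q_1\theta_{p_k}$ and $q'=p_k\theta_{q_1}$, $p_i'=p'\theta_{p_k}\cdots\theta_{p_i}$ and $q_j'=q'\theta_{q_1}\cdots\theta_{q_j}$. Each $p\in P$ is identified with $[\![p]\!]$, and its idempotents are the elements $[\![p,q]\!]$ with $p\mathrel{\mathscr F}q$. BOSETS. For a semigroup $S$ let $E=\mathbf E(S)=\{e\in S:e^2=e\}$ and $\mathrm{BP}(E)=\{(e,f)\in E\times E:\{e,f\}\cap\{ef,fe\}\neq\varnothing\}$;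 for $(e,f)\in\mathrm{BP}(E)$ one has $ef\in E$. The boset (biordered set) of $S$ is $E$ with the partial operation $(e,f)\mapsto ef$ defined exactly on $\mathrm{BP}(E)$. A boset is a partial algebra arising as the boset of some semigroup; it is regular if it is the boset of some regular semigroup. In a boset write $e\leq_l f$ iff $e=ef$, and $e\leq_r f$ iff $e=fe$. For $e,f\in E$ let $\mathsf M(e,f)=\{g\in E:ge=g=fg\}$, pre-ordered by $h\preceq g$ iff $eh\leq_r eg$ and $hf\leq_l gf$; the sandwich set is $\mathsf S(e,f)=\{g\in\mathsf M(e,f):h\preceq g\text{ for all }h\in\mathsf M(e,f)\}$. A regular $*$-boset is a regular boset $E$ with a unary operation $^*$ such that: $(e^* )^*=e$; if $(e,f)\in\mathrm{BP}(E)$ then $(e^*,f^* )\in\mathrm{BP}(E)$ and $(ef)^*=f^*e^*$; and for every $e\in E$ there are $s,t\in E$ with $se=e$, $es=s$, $e^*t=t$, $te^*=e^*$, $et=e$, $te=t$, $se^*=s$, $e^*s=e^*$, and $e^*(gs)=(tg)e^*$ for all $g\in E$ with $g\leq_l e$ and $g\leq_r e$. $\mathbf{RSBS}$ is the category of regular $*$-bosets, with morphisms (regular $*$-bimorphisms) the maps $\phi:E\to E'$ such that $(e,f)\in\mathrm{BP}(E)$ implies $(e\phi,f\phi)\in\mathrm{BP}(E')$ and $(ef)\phi=(e\phi)(f\phi)$; $\mathsf S(e,f)\phi\subseteq\mathsf S(e\phi,f\phi)$ for all $e,f\in E$; and $(e^* )\phi=(e\phi)^*$. FUNCTORS. $\mathbf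 E:\mathbf{PA}\to\mathbf{RSBS}$ sends $P$ to the regular $*$-boset $\mathbf E(P)=\mathbf E(\mathsf{PG}(P))=\{[\![p,q]\!]:p\mathrel{\mathscr F}q\}$ of $\mathsf{PG}(P)$ (with $[\![p,q]\!]^*=[\![q,p]\!]$), and $\phi:P\to P'$ to $[\![p,q]\!]\mapsto[\![p\phi,q\phi]\!]$. $\mathbf P:\mathbf{RSBS}\to\mathbf{PA}$ sends $E$ to $\mathbf P(E)=\{p\in E:p=p^*\}$ with $q\theta_p=p\,e(p,q)$, where $e(p,q)$ is the unique element $e\in\mathsf S(p,q)$ with $pe,eq\in\mathbf P(E)$ (such an element exists and is unique), and sends $\phi:E\to E'$ to $\phi|_{\mathbf P(E)}$. *)

(* Defs.v *)
Set Warnings "-notation-overridden".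
From HB Require Import structures.
From mathcomp Require Import all_boot.
From mathcomp Require Import boolp.

Set Implicit Arguments.
Unset Strict Implicit.
Unset Printing Implicit Defensive.

Reserved Notation "x '\th' p" (at level 40, left associativity).

Lemma sig_inj (T : Type) (Q : T -> Prop) (u v : {x | Q x}) :
  sval u = sval v -> u = v.
Proof. exact: eq_sig_hprop (fun _ => @Prop_irrelevance _) u v. Qed.

Record category := Category {
  obj :> Type;
  hom : obj -> obj -> Type;
  idm : forall X, hom X X;
  (* diagrammatic order: [comp f g] is f followed by g *)
  comp : forall X Y Z, hom X Y -> hom Y Z -> hom X Z;
  comp1m : forall X Y (f : hom X Y), comp (idm X) f = f;
  compm1 : forall X Y (f : hom X Y), comp f (idm Y) = f;
  compA : forall X Y Z T (f : hom X Y) (g : hom Y Z) (h : hom Z T),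
    comp f (comp g h) = comp (comp f g) h
}.
Arguments hom {c} X Y.
Arguments idm {c} X.
Arguments comp {c X Y Z} f g.

Record functor (C D : category) := Functor {
  fobj :> C -> D;
  fmap : forall X Y : C, hom X Y -> hom (fobj X) (fobj Y);
  fmap1 : forall X, fmap (idm X) = idm (fobj X);
  fmapM : forall X Y Z (f : hom X Y) (g : hom Y Z),
    fmap (comp f g) = comp (fmap f) (fmap g)
}.
Arguments fmap {C D} _ {X Y} _.

Definition functor_id (C : category) : functor C C :=
  @Functor C C id (fun _ _ => id) (fun _ => erefl) (fun _ _ _ _ _ => erefl).

(* [functor_comp G F] is the functor G o F, X |-> G (F X) *)
Definition functor_comp (C D E : category) (G : functor D E) (F : functor C D) :
  functor C E.
Proof.
apply: (@Functor C E (fun X => G (F X)) (fun X Y f => fmap G (fmap F f))).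
- by move=> X; rewrite !fmap1.
- by move=> X Y Z f g; rewrite !fmapM.
Defined.

Definition is_iso (C : category) (X Y : C) (f : hom X Y) :=
  exists g : hom Y X, comp f g = idm X /\ comp g f = idm Y.

Definition is_natural_iso (C D : category) (F G : functor C D)
    (eta : forall X, hom (F X) (G X)) :=
  (forall X Y (f : hom X Y), comp (fmap F f) (eta Y) = comp (eta X) (fmap G f))
  /\ forall X, is_iso (eta X).

Definition naturally_isomorphic (C D : category) (F G : functor C D) :=
  exists eta : forall X, hom (F X) (G X), is_natural_iso eta.

Definition equivalence_of_categories (C D : category)
    (F : functor C D) (G : functor D C) :=
  naturally_isomorphic (functor_comp G F) (functor_id C) /\
  naturally_isomorphic (functor_comp F G) (functor_id D).

Record projAlg := ProjAlg {
  pa_sort :> Type;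
  theta : pa_sort -> pa_sort -> pa_sort;
  theta_id : forall p, theta p p = p;
  thetaK : forall p x, theta p (theta p x) = theta p x;
  theta_sym : forall p q, theta p (theta q p) = theta p q;
  thetaJ : forall p q x, theta p (theta q (theta p x)) = theta (theta p q) x;
  thetaKK : forall p q x,
    theta q (theta p (theta q (theta p x))) = theta q (theta p x)
}.
(* Maps act on the right: x \th p is x theta_p = theta p x. *)
Notation "x '\th' p" := (theta p x).

Definition is_pa_morphism (P Q : projAlg) (phi : P -> Q) :=
  forall p q : P, phi (p \th q) = phi p \th phi q.

Definition pa_hom (P Q : projAlg) := {phi : P -> Q | is_pa_morphism phi}.

Definition pa_app (P Q : projAlg) (phi : pa_hom P Q) : P -> Q := sval phi.
Coercion pa_app : pa_hom >-> Funclass.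

Lemma pa_homP (P Q : projAlg) (f g : pa_hom P Q) : f =1 g -> f = g.
Proof. by move=> fg; apply/sig_inj/funext. Qed.

Definition pa_id (P : projAlg) : pa_hom P P.
Proof. by exists id. Defined.

Definition pa_comp (P Q R : projAlg) (f : pa_hom P Q) (g : pa_hom Q R) :
  pa_hom P R.
Proof.
exists (fun x => g (f x)) => p q.
by rewrite /pa_app (svalP f) (svalP g).
Defined.

Definition PA : category.
Proof.
apply: (@Category projAlg pa_hom pa_id pa_comp).
- by move=> X Y f; apply: pa_homP.
- by move=> X Y f; apply: pa_homP.
- by move=> X Y Z T f g h; apply: pa_homP.
Defined.

Section ProjAlgTheory.
Variable P : projAlg.
Implicit Types (p q r e f g x y z : P) (s t a b : seq P).

Definition leF p q := p = q \th p.
Definition Frel p q := leF p q /\ leF q p.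

Lemma FrelC p q : Frel p q -> Frel q p. Proof. by case. Qed.
Lemma Frelxx p : Frel p p. Proof. by split; rewrite /leF theta_id. Qed.

Definition linked p e f := f = e \th p \th f /\ e = f \th p \th e.

Fixpoint chain p s : Prop :=
  if s is q :: s' then Frel p q /\ chain q s' else True.

Definition is_ppath s : Prop := if s is p :: s' then chain p s' else False.

(* A path (p_1, ..., p_k) is the nonempty list [:: p_1; ...; p_k]; the
   composite of rcons a p and p :: b in the path category is a ++ p :: b. *)
Inductive pcong : seq P -> seq P -> Prop :=
| pcong_refl s : is_ppath s -> pcong s s
| pcong_sym s t : pcong s t -> pcong t s
| pcong_trans s t u : pcong s t -> pcong t u -> pcong s u
| pcong_comp a a' p b b' :
    pcong (rcons a p) (rcons a' p) -> pcong (p :: b) (p :: b') ->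
    pcong (a ++ p :: b) (a' ++ p :: b')
| pcong_id p : pcong [:: p; p] [:: p]
| pcong_inv p q : Frel p q -> pcong [:: p; q; p] [:: p]
| pcong_linked p e f : linked p e f ->
    pcong [:: e; e \th p; f] [:: e; f \th p; f].

(* [scanl act x [:: r_1; ...; r_n]] lists the x theta_{r_1} ... theta_{r_i} *)
Local Notation act := (fun x r => x \th r).

Definition pprod s t : seq P :=
  match rev s, t with
  | p :: _, q :: _ =>
      rev (scanl act (q \th p) (rev s)) ++ scanl act (p \th q) t
  | _, _ => [::]
  end.

Lemma theta_FrelE p q : Frel (q \th p) (p \th q).
Proof. by split; rewrite /leF -thetaJ thetaKK theta_sym. Qed.

Lemma Frel_step x q1 q2 : x = x \th q1 -> Frel q1 q2 -> Frel x (x \th q2).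
Proof.
move=> xq1 [q12 q21]; split; rewrite /leF.
- rewrite theta_sym {2}xq1 -thetaJ -q12 theta_sym; exact: xq1.
- by rewrite -thetaJ !theta_sym.
Qed.

Lemma chain_rho x q s : x = x \th q -> chain q s -> chain x (scanl act x s).
Proof.
elim: s x q => //= r s IHs x q xq [qr rs]; split; first exact: Frel_step xq qr.
by apply: (IHs _ r) => //; rewrite thetaK.
Qed.

Lemma ppath_rho x s : is_ppath s -> is_ppath (scanl act x s).
Proof. by case: s => //= q s; apply: chain_rho; rewrite thetaK. Qed.

Lemma chain_rcons p s q : chain p (rcons s q) <-> chain p s /\ Frel (last p s) q.
Proof. by elim: s p => [|r s IHs] p /=; [tauto|rewrite IHs; tauto]. Qed.

Lemma chain_cat p s t : chain p (s ++ t) <-> chain p s /\ chain (last p s) t.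
Proof. by elim: s p => [|r s IHs] p /=; [tauto|rewrite IHs; tauto]. Qed.

Lemma ppath_comp a p b :
  is_ppath (a ++ p :: b) <-> is_ppath (rcons a p) /\ is_ppath (p :: b).
Proof.
case: a => [|q a] /=; first tauto.
by rewrite chain_cat chain_rcons /=; tauto.
Qed.

Lemma ppath_cat a p q b : is_ppath (rcons a p ++ q :: b) <->
  [/\ is_ppath (rcons a p), Frel p q & is_ppath (q :: b)].
Proof.
rewrite cat_rcons ppath_comp /=; split; first by case=> ? [].
by case.
Qed.

Lemma ppath_rev s : is_ppath s -> is_ppath (rev s).
Proof.
case: s => // p s; elim: s p => [|q s IHs] p //= [pq /IHs].
rewrite !rev_cons -!cats1 -catA /= => qs; apply/ppath_comp.
by rewrite -cats1 /=; split=> //; split=> //; apply: FrelC.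
Qed.

Lemma linked_sym p e f : linked p e f -> linked p f e.
Proof. by case. Qed.

Lemma linked_ppath p e f : linked p e f -> is_ppath [:: e; e \th p; f].
Proof.
case=> fE eE.
have pe : e = p \th e.
  have h : f \th p \th e \th (p \th e) = f \th p \th e.
    by rewrite -thetaJ thetaK thetaKK.
  rewrite -eE in h.
  by rewrite -{1}h -thetaJ theta_id theta_sym.
split; last split=> //; split; rewrite /leF.
- by rewrite theta_sym.
- by rewrite -thetaJ theta_sym -pe.
- by rewrite -thetaJ -eE.
- exact: fE.
Qed.

Lemma pcong_ppath s t : pcong s t -> is_ppath s /\ is_ppath t.
Proof.
elim=> {s t}.
- by [].
- by move=> s t _ [].
- by move=> s t u _ [? _] _ [].
- by move=> a a' p b b' _ [? ?] _ [? ?]; split; apply/ppath_comp.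
- by move=> p; do !split; rewrite /leF theta_id.
- by move=> p q pq; split=> //=; do !split; case: pq.
- move=> p e f h; split; first exact: linked_ppath h.
  by have := ppath_rev (linked_ppath (linked_sym h)).
Qed.

Lemma pcong_head s t x : pcong s t -> head x s = head x t.
Proof.
elim=> {s t} //; first by move=> s t u _ -> _ ->.
by move=> [|q a] [|q' a'] p b b' _ /=.
Qed.

Lemma pcong_last s t x : pcong s t -> last x s = last x t.
Proof.
elim=> {s t} //; first by move=> s t u _ -> _ ->.
by move=> a a' p b b' _ _ _; rewrite !last_cat.
Qed.

Lemma pcong_rev s t : pcong s t -> pcong (rev s) (rev t).
Proof.
elim=> {s t}.
- by move=> s /ppath_rev; apply: pcong_refl.
- by move=> s t _; apply: pcong_sym.
- by move=> s t u _ + _; apply: pcong_trans.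
- move=> a a' p b b' _ + _.
  rewrite !rev_rcons !rev_cons !rev_cat !rev_cons !cat_rcons => h1 h2.
  exact: pcong_comp.
- exact: pcong_id.
- exact: pcong_inv.
- by move=> p e f h; apply/pcong_sym/pcong_linked/linked_sym.
Qed.

Lemma ppathP s : is_ppath s -> exists p a, s = p :: a.
Proof. by case: s => // p a; exists p, a. Qed.

Lemma ppathPr s : is_ppath s -> exists a p, s = rcons a p.
Proof. by case/lastP: s => // a p; exists a, p. Qed.

Lemma pcong_cat s s' t t' : pcong s s' -> pcong t t' -> is_ppath (s ++ t) ->
  pcong (s ++ t) (s' ++ t').
Proof.
move=> ss tt pst.
have [/ppathPr[a [p ?]] /ppathPr[a' [p' ?]]] := pcong_ppath ss; subst s s'.
have [/ppathP[q [b ?]] /ppathP[q' [b' ?]]] := pcong_ppath tt; subst t t'.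
have := pcong_last p ss; rewrite !last_rcons => ?; subst p'.
have /= ? := pcong_head q tt; subst q'.
have /ppath_cat[_ pq _] := pst.
rewrite !cat_rcons.
have h : pcong (a ++ [:: p; q]) (a' ++ [:: p; q]).
  by apply: pcong_comp => //; apply: pcong_refl.
have -> : a ++ [:: p, q & b] = rcons a p ++ q :: b by rewrite cat_rcons.
have -> : a' ++ [:: p, q & b'] = rcons a' p ++ q :: b' by rewrite cat_rcons.
by apply: pcong_comp => //; rewrite -!cats1 -!catA.
Qed.

Lemma scanl_rcons x s p :
  scanl act x (rcons s p) = rcons (scanl act x s) (foldl act x s \th p).
Proof. by elim: s x => //= q s IHs x; rewrite IHs. Qed.

Lemma scanl_catE x s t :
  scanl act x (s ++ t) = scanl act x s ++ scanl act (foldl act x s) t.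
Proof. by elim: s x => //= q s IHs x; rewrite IHs. Qed.

Lemma linked_act p e f x : linked p e f -> x = x \th e ->
  [/\ x \th (e \th p) = x \th p,
      x \th (e \th p) \th f = x \th p \th f,
      x \th (f \th p) = x \th p \th f \th p,
      x \th (f \th p) \th f = x \th p \th f &
      linked p x (x \th p \th f)].
Proof.
move=> [fE eE] xe.
have h1 : x \th (e \th p) = x \th p.
  by rewrite -thetaJ {1}xe thetaKK -xe.
have h2 : x \th p \th f \th p \th x = x.
  rewrite thetaJ theta_sym [X in _ \th X]xe -thetaJ -eE.
  by rewrite theta_sym -xe.
split=> //; first by rewrite h1.
- by rewrite -thetaJ.
- by rewrite -thetaJ thetaKK.
- by split; rewrite ?h2 // -thetaJ -thetaJ h2.
Qed.

Lemma pcong_rho s t x : pcong s t ->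
  foldl act x s = foldl act x t /\ pcong (scanl act x s) (scanl act x t).
Proof.
move=> st; elim: st x => {s t}.
- by move=> s ps x; split=> //; apply/pcong_refl/ppath_rho.
- by move=> s t _ IH x; have [? ?] := IH x; split=> //; apply: pcong_sym.
- move=> s t u _ IH1 _ IH2 x; have [-> h1] := IH1 x; have [-> h2] := IH2 x.
  by split=> //; apply: pcong_trans h1 h2.
- move=> a a' p b b' _ IH1 _ IH2 x; have [] := IH1 x.
  rewrite !foldl_rcons !scanl_rcons !foldl_cat !scanl_catE /= => aE h1.
  have [] := IH2 (foldl act x a); rewrite /= => bE h2.
  rewrite -aE in h1 *; split=> //; exact: pcong_comp h1 h2.
- by move=> p x /=; rewrite thetaK; split=> //; apply: pcong_id.
- move=> p q pq x /=.
  have pE : x \th p \th q \th p = x \th p by rewrite thetaJ; case: pq => <-.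
  rewrite pE; split=> //; apply: pcong_inv.
  by apply: (@Frel_step _ p) => //; rewrite thetaK.
- move=> p e f h x /=.
  have [h1 h2 h3 h4 h5] := linked_act h (esym (thetaK e x)).
  rewrite h2 h4 h1 h3; split=> //; exact: pcong_linked.
Qed.

Lemma pprodE a p q b : pprod (rcons a p) (q :: b) =
  rev (scanl act q (rev (rcons a p))) ++ scanl act p (q :: b).
Proof. by rewrite /pprod rev_rcons /= !thetaK. Qed.

Lemma pprod_ppath s t : is_ppath s -> is_ppath t -> is_ppath (pprod s t).
Proof.
move=> ps pt; have [a [p ?]] := ppathPr ps; have [q [b ?]] := ppathP pt.
subst s t; rewrite pprodE.
have := ppath_rev (ppath_rho q (ppath_rev ps)); have := ppath_rho p pt.
rewrite rev_rcons /= rev_cons => h1 h2; apply/ppath_cat.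
by split=> //; apply: theta_FrelE.
Qed.

Lemma pprod_pcong s s' t t' : pcong s s' -> pcong t t' ->
  pcong (pprod s t) (pprod s' t').
Proof.
move=> ss tt; have [ps ps'] := pcong_ppath ss; have [pt pt'] := pcong_ppath tt.
have := pprod_ppath ps pt.
have [a [p ?]] := ppathPr ps; have [q [b ?]] := ppathP pt.
have [a' [p' ?]] := ppathPr ps'; have [q' [b' ?]] := ppathP pt'.
subst s s' t t'; have := pcong_last p ss; rewrite !last_rcons => ?; subst p'.
have /= ? := pcong_head q tt; subst q'; rewrite !pprodE.
apply: pcong_cat; first by apply/pcong_rev; have [] := pcong_rho q (pcong_rev ss).
by have [] := pcong_rho p tt.
Qed.

Lemma pprod_rev s t : is_ppath s -> is_ppath t ->
  rev (pprod s t) = pprod (rev t) (rev s).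
Proof.
move=> ps pt; have [a [p ?]] := ppathPr ps; have [q [b ?]] := ppathP pt.
subst s t; rewrite [in RHS]rev_rcons [in RHS]rev_cons !pprodE rev_cat revK.
by rewrite -!rev_cons revK -rev_rcons.
Qed.

Lemma rho_rev q s p : is_ppath (rcons s p) -> Frel p q ->
  rev (scanl act q (rev (rcons s p))) = rcons s p.
Proof.
move=> ps pq; apply: (canLR revK).
move: (ppath_rev ps); rewrite rev_rcons; move: (rev s) => {ps} {}s.
elim: s p q pq => [|r s IHs] p q [pq qp] /=; first by rewrite -pq.
case=> pr rs; congr cons; first by rewrite -pq.
by rewrite -pq; apply: IHs => //; apply: FrelC.
Qed.

Lemma rho_chain p q s : is_ppath (q :: s) -> Frel p q ->
  scanl act p (q :: s) = q :: s.
Proof.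
elim: s p q => [|r s IHs] p q /=; first by move=> _ [_ <-].
by move=> [qr rs] [_ <-]; congr cons; apply: IHs.
Qed.

Lemma pprod_cat a p q b : is_ppath (rcons a p ++ q :: b) ->
  pprod (rcons a p) (q :: b) = rcons a p ++ q :: b.
Proof.
by move=> /ppath_cat[pa pq pb]; rewrite pprodE rho_rev // rho_chain.
Qed.

Lemma rho_rho z y s : z = z \th y -> scanl act z (scanl act y s) = scanl act z s.
Proof.
elim: s z y => //= r s IHs z y zy.
have E : z \th (y \th r) = z \th r by rewrite -thetaJ {1}zy thetaKK -zy.
by rewrite E; congr cons; apply: IHs; rewrite -E thetaK.
Qed.

Lemma rho_rho1 p q w s : scanl act (w \th (p \th q)) (scanl act q (p :: s)) =
  scanl act (w \th q) (p :: s).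
Proof.
rewrite /=; have E : w \th (p \th q) \th (q \th p) = w \th q \th p.
  by rewrite -!thetaJ thetaKK thetaKK.
by rewrite E; congr cons; apply: rho_rho; rewrite -E thetaK.
Qed.

Lemma theta_linked p q w : linked q (w \th q \th p) (p \th q \th w).
Proof.
have h x y : y \th q \th x = x \th q \th y \th q \th (y \th q \th x).
  by rewrite -[RHS]thetaJ (thetaJ q y x) !theta_sym.
by split; apply: h.
Qed.

Lemma pprodA1 s q u : is_ppath s -> is_ppath u ->
  pcong (pprod s (pprod [:: q] u)) (pprod (pprod s [:: q]) u).
Proof.
move=> ps pu; have [a [p ?]] := ppathPr ps; have [w [b ?]] := ppathP pu.
subst s u.
rewrite (pprodE [::] q w b) (pprodE a p q [::]).
rewrite [rev (scanl _ w _)]/= [scanl _ p [:: q]]/= cat1s cats1 !pprodE.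
rewrite [rev (rcons (rev _) _)]rev_rcons revK.
rewrite [scanl _ p (_ :: _)]/= [scanl _ w (_ :: _)]/= rev_rcons !rho_rho1.
have := ppath_rev (ppath_rho (w \th q) (ppath_rev ps)).
have := ppath_rho (p \th q) pu.
rewrite rev_rcons /= !rev_cons; set X := rev _ => h1 h2.
rewrite !cat_rcons; apply: pcong_comp; first exact: pcong_refl.
have [E1] := rho_rho1 w q p b; rewrite E1 => ->.
apply: (@pcong_comp [:: _; _] [:: _; _]); last exact: pcong_refl.
apply/pcong_sym; rewrite -!thetaJ; apply: pcong_linked; exact: theta_linked.
Qed.

Lemma pprodA s t u : is_ppath s -> is_ppath t -> is_ppath u ->
  pcong (pprod s (pprod t u)) (pprod (pprod s t) u).
Proof.
case: t => // p t; elim: t p s => [|q t IHt] p s ps pt pu.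
  exact: pprodA1.
have tE : pprod [:: p] (q :: t) = [:: p, q & t] by apply: (@pprod_cat [::]).
have qt : is_ppath (q :: t) by case: pt.
have pp : is_ppath [:: p] by [].
have r v (pv : is_ppath v) := pcong_refl pv.
rewrite -tE.
apply: (@pcong_trans _ (pprod s (pprod [:: p] (pprod (q :: t) u)))).
  by apply: pprod_pcong; [exact: r | apply/pcong_sym; exact: IHt].
apply: pcong_trans (pprodA1 _ ps (pprod_ppath qt pu)) _.
apply: pcong_trans (IHt _ _ (pprod_ppath ps pp) qt pu) _.
by apply: pprod_pcong; [apply/pcong_sym; exact: pprodA1 | exact: r].
Qed.

Lemma pcong_cancel p s : is_ppath (p :: s) ->
  pcong ((p :: s) ++ rev (p :: s)) [:: p].
Proof.
elim: s p => [|q s IHs] p /=; first by move=> _; apply: pcong_id.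
case=> pq qs; have h := IHs q qs.
rewrite rev_cons -cats1 catA.
apply: pcong_trans (pcong_inv pq).
rewrite -[p :: _]/([:: p] ++ (((q :: s) ++ rev (q :: s)) ++ [:: p])).
rewrite -[[:: p; q; p]]/([:: p] ++ ([:: q] ++ [:: p])).
have [qq _] := pcong_ppath h.
have qp : is_ppath (((q :: s) ++ rev (q :: s)) ++ [:: p]).
  rewrite rev_cons -rcons_cat; apply/ppath_cat; split=> //.
    by rewrite rcons_cat -rev_cons.
  exact: FrelC.
apply: pcong_cat; [exact: pcong_refl | | by split].
by apply: pcong_cat => //; apply: pcong_refl.
Qed.

Lemma pprod_rev_cancel s : is_ppath s -> pcong (pprod (pprod s (rev s)) s) s.
Proof.
move=> ps; have psr := ppath_rev ps.
have -> : pprod s (rev s) = s ++ rev s.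
  move: psr; have [a [p ?]] := ppathPr ps; subst s; rewrite rev_rcons => psr.
  by apply: pprod_cat; apply/ppath_cat; split=> //; apply: Frelxx.
have [p [b ?]] := ppathP ps; subst s.
apply: (@pcong_trans _ (pprod [:: p] (p :: b))).
  by apply: pprod_pcong; [exact: pcong_cancel | exact: pcong_refl].
rewrite (@pprod_cat [::] p p b); last by split=> //; apply: Frelxx.
apply: (@pcong_comp [:: p] [::]); last exact: pcong_refl.
exact: pcong_id.
Qed.

End ProjAlgTheory.

Section PathMap.
Variables (P Q : projAlg) (phi : pa_hom P Q).

Lemma pa_homE p q : phi (p \th q) = phi p \th phi q.
Proof. exact: (svalP phi). Qed.

Lemma map_Frel p q : Frel p q -> Frel (phi p) (phi q).
Proof. by case=> h1 h2; split; rewrite /leF -pa_homE -?h1 -?h2. Qed.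

Lemma map_ppath s : is_ppath s -> is_ppath (map phi s).
Proof.
by case: s => //= p s; elim: s p => //= q s IHs p [/map_Frel ? /IHs].
Qed.

Lemma map_pcong s t : pcong s t -> pcong (map phi s) (map phi t).
Proof.
elim=> {s t} /=.
- by move=> s /map_ppath; apply: pcong_refl.
- by move=> s t _; apply: pcong_sym.
- by move=> s t u _ + _; apply: pcong_trans.
- move=> a a' p b b' _ + _; rewrite !map_rcons !map_cat /=.
  exact: pcong_comp.
- by move=> p; apply: pcong_id.
- by move=> p q /map_Frel; apply: pcong_inv.
- move=> p e f [h1 h2]; rewrite !pa_homE; apply: pcong_linked.
  by split; rewrite -!pa_homE -?h1 -?h2.
Qed.

Lemma map_pprod s t : map phi (pprod s t) = pprod (map phi s) (map phi t).
Proof.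
have h x u : map phi (scanl (fun x r => x \th r) x u) =
             scanl (fun x r => x \th r) (phi x) (map phi u).
  by elim: u x => //= r u IHu x; rewrite IHu pa_homE.
rewrite /pprod -map_rev; case: (rev s) => //= p s'.
by case: t => //= q t'; rewrite map_cat map_rev /= !h /= !pa_homE.
Qed.

End PathMap.

Local Open Scope group_scope.

HB.mixin Record isRegularStar S of Semigroup S := {
  star : S -> S;
  starK : involutive star;
  mul_star_mul : forall a : S, a * star a * a = a;
  starM : forall a b : S, star (a * b) = star b * star a
}.

#[short(type="regularStarSemigroupType")]
HB.structure Definition RegularStarSemigroup :=
  {S of isRegularStar S & Semigroup S}.

Definition is_regular (S : semigroupType) :=
  forall a : S, exists b, a * b * a = a.

(* The elements of PG(P) are the congruence classes of P-paths. *)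
Definition PG (P : projAlg) : Type :=
  {C : seq P -> Prop | exists2 s : seq P, is_ppath s & C = pcong s}.

Section PG.
Variable P : projAlg.
Implicit Types C D : PG P.

Definition pgclass (s : seq P) (ps : is_ppath s) : PG P :=
  exist _ (pcong s) (ex_intro2 _ _ s ps erefl).

Lemma pgclassP C : exists s, exists ps : is_ppath s, C = pgclass ps.
Proof. by case: C => C [s ps CE]; exists s, ps; apply: sig_inj. Qed.

Lemma pcong_eqP (s t : seq P) : is_ppath t -> pcong s = pcong t <-> pcong s t.
Proof.
move=> pt; split=> [->|st]; first exact: pcong_refl.
apply/funext => u; apply/propext; split; apply: pcong_trans => //.
exact: pcong_sym.
Qed.

Lemma pgclass_eq (s t : seq P) (ps : is_ppath s) (pt : is_ppath t) :
  pgclass ps = pgclass pt <-> pcong s t.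
Proof.
split=> [[] | st]; first by move/pcong_eqP; apply.
by apply: sig_inj => /=; apply/pcong_eqP.
Qed.

Fact pg_mul_subproof C D : exists2 s : seq _, is_ppath s &
  (fun u => exists s t, [/\ sval C s, sval D t & pcong (pprod s t) u]) = pcong s.
Proof.
have [s [ps ->]] := pgclassP C; have [t [pt ->]] := pgclassP D.
exists (pprod s t); first exact: pprod_ppath.
apply/funext => u; apply/propext; split=> /=.
  by case=> s' [t' [ss tt]]; apply/pcong_trans/pprod_pcong.
by move=> h; exists s, t; split=> //; apply: pcong_refl.
Qed.

Definition pg_mul C D : PG P := exist _ _ (pg_mul_subproof C D).

Fact pg_star_subproof C : exists2 s : seq _, is_ppath s &
  (fun u => exists2 s, sval C s & pcong (rev s) u) = pcong s.
Proof.
have [s [ps ->]] := pgclassP C; exists (rev s); first exact: ppath_rev.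
apply/funext => u; apply/propext; split=> /=.
  by case=> s' ss; apply/pcong_trans/pcong_rev.
by move=> h; exists s => //; apply: pcong_refl.
Qed.

Definition pg_star C : PG P := exist _ _ (pg_star_subproof C).

Lemma pg_mulE (s t : seq P) (ps : is_ppath s) (pt : is_ppath t) :
  pg_mul (pgclass ps) (pgclass pt) = pgclass (pprod_ppath ps pt).
Proof.
apply: sig_inj => /=; apply/funext => u; apply/propext; split=> /=.
  by case=> s' [t' [ss tt]]; apply/pcong_trans/pprod_pcong.
by move=> h; exists s, t; split=> //; apply: pcong_refl.
Qed.

Lemma pg_starE (s : seq P) (ps : is_ppath s) :
  pg_star (pgclass ps) = pgclass (ppath_rev ps).
Proof.
apply: sig_inj => /=; apply/funext => u; apply/propext; split=> /=.
  by case=> s' ss; apply/pcong_trans/pcong_rev.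
by move=> h; exists s => //; apply: pcong_refl.
Qed.

Fact pg_mulA : associative pg_mul.
Proof.
move=> C D F; have [s [ps ->]] := pgclassP C; have [t [pt ->]] := pgclassP D.
have [u [pu ->]] := pgclassP F; rewrite !pg_mulE; apply/pgclass_eq.
exact: pprodA.
Qed.

Fact pg_starK : involutive pg_star.
Proof.
move=> C; have [s [ps ->]] := pgclassP C; rewrite !pg_starE; apply/pgclass_eq.
by rewrite revK; apply: pcong_refl.
Qed.

Fact pg_mul_star_mul C : pg_mul (pg_mul C (pg_star C)) C = C.
Proof.
have [s [ps ->]] := pgclassP C; rewrite pg_starE !pg_mulE; apply/pgclass_eq.
exact: pprod_rev_cancel.
Qed.

Fact pg_starM C D : pg_star (pg_mul C D) = pg_mul (pg_star D) (pg_star C).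
Proof.
have [s [ps ->]] := pgclassP C; have [t [pt ->]] := pgclassP D.
rewrite !(pg_starE, pg_mulE); apply/pgclass_eq; rewrite -pprod_rev //.
exact/pcong_refl/ppath_rev/pprod_ppath.
Qed.

HB.instance Definition _ := gen_eqMixin (PG P).
HB.instance Definition _ := gen_choiceMixin (PG P).
HB.instance Definition _ := isSemigroup.Build (PG P) pg_mulA.
HB.instance Definition _ :=
  isRegularStar.Build (PG P) pg_starK pg_mul_star_mul pg_starM.

(* [[p]] and [[p, q]] *)
Definition pg1 (p : P) : PG P := @pgclass [:: p] I.
Definition pg2 (p q : P) (pq : Frel p q) : PG P := @pgclass [:: p; q] (conj pq I).

Lemma pg_mul_star C : exists p, C * star C = pg1 p.
Proof.
have [s [ps ->]] := pgclassP C; have [p [b ?]] := ppathP ps; subst s.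
exists p; rewrite /star /mul /= pg_starE pg_mulE; apply/pgclass_eq.
apply: pcong_trans (pcong_cancel ps).
move: (ps) (ppath_rev ps); have [a [q ->]] := ppathPr ps; rewrite rev_rcons => h1 h2.
rewrite (@pprod_cat _ a q q (rev a)); last first.
  by apply/ppath_cat; split=> //; apply: Frelxx.
by apply/pcong_refl/ppath_cat; split=> //; apply: Frelxx.
Qed.

Lemma pg_idemP C : C * C = C <-> exists p q, exists pq : Frel p q, C = pg2 pq.
Proof.
split=> [CC | [p [q [pq ->]]]].
  have CE : C = C * star C * (star C * star (star C)).
    by rewrite starK -!mulgA (mulgA (star C)) -starM CC !mulgA mul_star_mul.
  have [p pE] := pg_mul_star C; have [q qE] := pg_mul_star (star C).
  exists (q \th p), (p \th q), (theta_FrelE p q); rewrite CE pE qE.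
  rewrite /mul /= /pg1 pg_mulE; apply/pgclass_eq.
  rewrite /pprod /= !thetaK; apply/pcong_refl; split=> //.
  exact: theta_FrelE.
rewrite /mul /= /pg2 pg_mulE; apply/pgclass_eq; case: (pq) => h1 h2.
rewrite (@pprod_cat _ [:: p] q p [:: q]); last by do !split.
apply: (@pcong_comp _ [:: p; q] [::]); first exact: pcong_inv.
by apply: pcong_refl; split.
Qed.

End PG.

Section PGMap.
Variables (P Q : projAlg) (phi : pa_hom P Q).

Fact pg_map_subproof (C : PG P) : exists2 s : seq _, is_ppath s &
  (fun u => exists2 s, sval C s & pcong (map phi s) u) = pcong s.
Proof.
have [s [ps ->]] := pgclassP C; exists (map phi s); first exact: map_ppath.
apply/funext => u; apply/propext; split=> /=.
  by case=> s' ss; apply/pcong_trans/map_pcong.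
by move=> h; exists s => //; apply: pcong_refl.
Qed.

Definition pg_map (C : PG P) : PG Q := exist _ _ (pg_map_subproof C).

Lemma pg_mapE (s : seq P) (ps : is_ppath s) :
  pg_map (pgclass ps) = pgclass (map_ppath phi ps).
Proof.
apply: sig_inj => /=; apply/funext => u; apply/propext; split=> /=.
  by case=> s' ss; apply/pcong_trans/map_pcong.
by move=> h; exists s => //; apply: pcong_refl.
Qed.

Lemma pg_mapM C D : pg_map (C * D) = pg_map C * pg_map D.
Proof.
have [s [ps ->]] := pgclassP C; have [t [pt ->]] := pgclassP D.
rewrite /mul /= pg_mulE !pg_mapE pg_mulE; apply/pgclass_eq.
by rewrite map_pprod; apply/pcong_refl/pprod_ppath; apply/map_ppath.
Qed.

Lemma pg_map_star C : pg_map (star C) = star (pg_map C).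
Proof.
have [s [ps ->]] := pgclassP C.
rewrite /star /= pg_starE !pg_mapE pg_starE; apply/pgclass_eq.
by rewrite map_rev; apply/pcong_refl/ppath_rev/map_ppath.
Qed.

End PGMap.

(* [pdot e f g] : the product of e and f is defined and equal to g *)
Record partialMagma := PartialMagma {
  pm_sort :> Type;
  pdot : pm_sort -> pm_sort -> pm_sort -> Prop
}.
Arguments pdot {p} _ _ _.

Section Boset.
Variable E : partialMagma.
Implicit Types e f g h : E.

Definition BP e f := exists g, pdot e f g.
Definition le_l e f := pdot e f e.
Definition le_r e f := pdot f e e.

Definition Mset e f g := pdot g e g /\ pdot f g g.

Definition Mset_le e f h g :=
  (exists a b, [/\ pdot e h a, pdot e g b & le_r a b]) /\
  (exists a b, [/\ pdot h f a, pdot g f b & le_l a b]).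

Definition sandwich e f g := Mset e f g /\ forall h, Mset e f h -> Mset_le e f h g.

End Boset.

Definition partial_iso (E F : partialMagma) (j : E -> F) :=
  bijective j /\ forall e f g : E, pdot e f g <-> pdot (j e) (j f) (j g).

Definition basic_pair (S : semigroupType) (e f : S) :=
  (e * f = e \/ e * f = f) \/ (f * e = e \/ f * e = f).

Definition boset_of (S : semigroupType) : partialMagma :=
  @PartialMagma {e : S | e * e = e}
    (fun e f g => basic_pair (sval e) (sval f) /\ sval e * sval f = sval g).

(* a boset is taken up to isomorphism of partial algebras *)
Definition is_regular_boset (E : partialMagma) :=
  exists (S : semigroupType) (j : E -> boset_of S), is_regular S /\ partial_iso j.

Definition is_regular_star_boset (E : partialMagma) (st : E -> E) :=
  [/\ is_regular_boset E,
      forall e, st (st e) = e,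
      forall e f g, pdot e f g ->
        BP (st e) (st f) /\ pdot (st f) (st e) (st g) &
      forall e, exists s t,
        [/\ pdot s e e /\ pdot e s s,
            pdot (st e) t t /\ pdot t (st e) (st e),
            pdot e t e /\ pdot t e t,
            pdot s (st e) s /\ pdot (st e) s (st e) &
            forall g, le_l g e -> le_r g e -> exists gs tg x,
              [/\ pdot g s gs, pdot t g tg,
                  pdot (st e) gs x & pdot tg (st e) x]]].

Record rsBoset := RSBoset {
  rsb_boset :> partialMagma;
  rsb_star : rsb_boset -> rsb_boset;
  rsbP : is_regular_star_boset rsb_star
}.

Definition is_rsb_morphism (E F : rsBoset) (phi : E -> F) :=
  [/\ forall e f g : E, pdot e f g -> pdot (phi e) (phi f) (phi g),
      forall e f g : E, sandwich e f g -> sandwich (phi e) (phi f) (phi g) &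
      forall e : E, phi (rsb_star e) = rsb_star (phi e)].

Definition rsb_hom (E F : rsBoset) := {phi : E -> F | is_rsb_morphism phi}.

Definition rsb_app (E F : rsBoset) (phi : rsb_hom E F) : E -> F := sval phi.
Coercion rsb_app : rsb_hom >-> Funclass.

Lemma rsb_homP (E F : rsBoset) (f g : rsb_hom E F) : f =1 g -> f = g.
Proof. by move=> fg; apply/sig_inj/funext. Qed.

Definition rsb_id (E : rsBoset) : rsb_hom E E.
Proof. by exists id. Defined.

Definition rsb_comp (E F G : rsBoset) (f : rsb_hom E F) (g : rsb_hom F G) :
  rsb_hom E G.
Proof.
exists (fun x => g (f x)); have [f1 f2 f3] := svalP f; have [g1 g2 g3] := svalP g.
split=> [e e' e'' /f1/g1|e e' e'' /f2/g2|e] //.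
by rewrite /rsb_app f3 g3.
Defined.

Definition RSBS : category.
Proof.
apply: (@Category rsBoset rsb_hom rsb_id rsb_comp).
- by move=> X Y f; apply: rsb_homP.
- by move=> X Y f; apply: rsb_homP.
- by move=> X Y Z T f g h; apply: rsb_homP.
Defined.

Section BosetOf.
Variable S : semigroupType.
Implicit Types e f g : boset_of S.

Lemma regular_inverse (a : S) : is_regular S ->
  exists b, a * b * a = a /\ b * a * b = b.
Proof.
move=> /(_ a)[b bE]; exists (b * a * b).
have bx x : a * (b * (a * x)) = a * x by rewrite !mulgA bE.
by split; rewrite -!mulgA ?bx // mulgA.
Qed.

Lemma boset_of_idem e : sval e * sval e = sval e. Proof. exact: svalP e. Qed.

Lemma le_lE e f : le_l e f <-> sval e * sval f = sval e.
Proof. by split=> [[]//|h]; split=> //; left; left. Qed.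

Lemma le_rE e f : le_r e f <-> sval f * sval e = sval e.
Proof. by split=> [[]//|h]; split=> //; left; right. Qed.

Lemma boset_ofP (a : S) : a * a = a -> exists e : boset_of S, sval e = a.
Proof. by move=> aa; exists (exist (fun x : S => x * x = x) a aa). Qed.

(* Nambooripad's description of sandwich sets in regular semigroups *)
Lemma sandwichE e f g : is_regular S -> sandwich e f g <->
  [/\ sval g * sval e = sval g, sval f * sval g = sval g &
      sval e * sval g * sval f = sval e * sval f].
Proof.
move=> regS; have ee := boset_of_idem e; have ff := boset_of_idem f.
have suff1 g' : [/\ sval g' * sval e = sval g', sval f * sval g' = sval g' &
    sval e * sval g' * sval f = sval e * sval f] -> sandwich e f g'.
  case=> [ge fg egf]; have gg := boset_of_idem g'.
  split; first by split; [apply/le_lE | apply/le_rE].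
  move=> h [/le_lE he /le_rE fh]; have hh := boset_of_idem h.
  have idl (k : boset_of S) : sval k * sval e = sval k ->
      (sval e * sval k) * (sval e * sval k) = sval e * sval k.
    by move=> ke; rewrite -!mulgA (mulgA (sval k)) ke boset_of_idem.
  have idr (k : boset_of S) : sval f * sval k = sval k ->
      (sval k * sval f) * (sval k * sval f) = sval k * sval f.
    by move=> fk; rewrite -!mulgA (mulgA (sval f)) fk mulgA boset_of_idem.
  have [eh ehE] := boset_ofP (idl _ he); have [eg egE] := boset_ofP (idl _ ge).
  have [hf hfE] := boset_ofP (idr _ fh); have [gf gfE] := boset_ofP (idr _ fg).
  split.
  - exists eh, eg; split.
    + by split; [right; right | rewrite ehE].
    + by split; [right; right | rewrite egE].
    + apply/le_rE; rewrite ehE egE -!mulgA (mulgA (sval g')) ge.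
      by rewrite -{1}fh !mulgA egf -mulgA fh.
  - exists hf, gf; split.
    + by split; [right; left | rewrite hfE].
    + by split; [right; left | rewrite gfE].
    + apply/le_lE; rewrite hfE gfE -!mulgA (mulgA (sval f)) fg.
      by rewrite -{1}he -!mulgA (mulgA (sval e)) egf mulgA he.
split; last exact: suff1.
case=> [[/le_lE ge /le_rE fg] gmax]; split=> //.
have [c [aca cac]] := regular_inverse (sval e * sval f) regS.
have [h hE] : exists h : boset_of S, sval h = sval f * c * sval e.
  by apply: boset_ofP; rewrite -!mulgA; congr (_ * _);
    rewrite -[in RHS]cac -!mulgA.
have he : sval h * sval e = sval h by rewrite hE -!mulgA ee.
have fh : sval f * sval h = sval h by rewrite hE !mulgA ff.
have ehf : sval e * sval h * sval f = sval e * sval f.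
  by rewrite -[in RHS]aca hE !mulgA.
have hM : Mset e f h by split; [apply/le_lE | apply/le_rE].
have [[eh [eg [[_ ehE] [_ egE] /le_rE h1]]] _] := gmax h hM.
have {}h1 : sval e * sval g * sval h = sval e * sval h.
  by rewrite -ehE -egE in h1; rewrite -[RHS]h1 -!mulgA (mulgA (sval g)) ge.
have <- : sval e * sval g * (sval e * sval f) = sval e * sval g * sval f.
  by rewrite mulgA -(mulgA _ (sval g)) ge.
by rewrite -ehf !mulgA -(mulgA _ (sval g)) ge h1.
Qed.

End BosetOf.

Section StarBoset.
Variable S : regularStarSemigroupType.
Implicit Types a b : S.

Lemma regular_star_regular : is_regular S.
Proof. by move=> a; exists (star a); apply: mul_star_mul. Qed.

Lemma star_mul_star a : star a * a * star a = star a.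
Proof. by rewrite -{2}(starK a) mul_star_mul. Qed.

Fact boset_star_subproof (e : boset_of S) :
  star (sval e) * star (sval e) = star (sval e).
Proof. by rewrite -starM boset_of_idem. Qed.

Definition boset_star (e : boset_of S) : boset_of S :=
  exist (fun x : S => x * x = x) _ (boset_star_subproof e).

Lemma basic_pairC (T : semigroupType) (e f : T) : basic_pair e f -> basic_pair f e.
Proof. by case=> [[]|[]] h; [right;right|right;left|left;right|left;left]. Qed.

Lemma basic_pair_star a b : basic_pair a b -> basic_pair (star a) (star b).
Proof.
by case=> [[]|[]] h; [right; left|right; right|left; left|left; right];
   rewrite -starM h.
Qed.

Lemma basic_idem (T : semigroupType) (e f : T) :
  e * e = e -> f * f = f -> basic_pair e f -> e * f * (e * f) = e * f.
Proof.
move=> ee ff [[]|[]] h.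
- by rewrite !h ee.
- by rewrite !h ff.
- by rewrite -mulgA (mulgA f) h mulgA ee.
- by rewrite -mulgA (mulgA f) h ff.
Qed.

Lemma BP_boset_of (T : semigroupType) (e f : boset_of T) :
  BP e f <-> basic_pair (sval e) (sval f).
Proof.
split=> [[g []]//|h].
have [g gE] := boset_ofP (basic_idem (boset_of_idem e) (boset_of_idem f) h).
by exists g.
Qed.

Lemma boset_of_regular_star : is_regular_star_boset boset_star.
Proof.
split.
- exists S, id; split; first exact: regular_star_regular.
  by split=> //; exists id.
- by move=> e; apply: sig_inj; rewrite /= starK.
- move=> e f g [/= ef <-]; split.
    by apply/BP_boset_of; apply: basic_pair_star.
  by split=> /=; [apply/basic_pairC/basic_pair_star | rewrite starM].
- move=> e; have ee := boset_of_idem e.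
  pose a := sval e; pose b := star a.
  have aba : a * b * a = a by apply: mul_star_mul.
  have bab : b * a * b = b by apply: star_mul_star.
  have aa : a * a = a by [].
  have bb : b * b = b by exact: boset_star_subproof.
  have [s sE] : exists s : boset_of S, sval s = a * b.
    by apply: boset_ofP; rewrite mulgA aba.
  have [t tE] : exists t : boset_of S, sval t = b * a.
    by apply: boset_ofP; rewrite mulgA bab.
  exists s, t; split.
  + by split; [apply/le_rE | apply/le_rE]; rewrite sE // mulgA aa.
  + by split; [apply/le_rE | apply/le_rE]; rewrite tE //= mulgA bb.
  + by split; [apply/le_lE | apply/le_lE]; rewrite tE -?mulgA ?aa // mulgA aba.
  + by split; [apply/le_lE | apply/le_lE]; rewrite sE /= -?mulgA ?bb // mulgA bab.
  + move=> g /le_lE ge /le_rE eg; have gg := boset_of_idem g.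
    rewrite -/a in ge eg.
    have sg : sval s * sval g = sval g.
      by rewrite sE -[in LHS]eg mulgA aba eg.
    have gt : sval g * sval t = sval g.
      by rewrite tE -[in LHS]ge -mulgA (mulgA a) aba ge.
    have bp1 : basic_pair (sval g) (sval s) by right; left.
    have bp2 : basic_pair (sval t) (sval g) by right; right.
    have [gs gsE] := boset_ofP (basic_idem gg (boset_of_idem s) bp1).
    have [tg tgE] := boset_ofP (basic_idem (boset_of_idem t) gg bp2).
    have bp3 : basic_pair b (sval gs).
      by right; right; rewrite gsE sE -!mulgA bb.
    have bp4 : basic_pair (sval tg) b.
      by right; left; rewrite tgE tE !mulgA bb.
    have [x xE] := boset_ofP (basic_idem bb (boset_of_idem gs) bp3).
    exists gs, tg, x; split; split=> //; rewrite xE gsE tgE sE tE /=.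
    by rewrite -/a -/b !mulgA -(mulgA b _ a) ge -(mulgA b a) eg.
Qed.

Definition boset_of_rsb : rsBoset := RSBoset boset_of_regular_star.

End StarBoset.

Section StarHom.
Variables (S T : regularStarSemigroupType) (f : S -> T).
Hypothesis fM : forall a b, f (a * b) = f a * f b.
Hypothesis f_star : forall a, f (star a) = star (f a).

Fact boset_map_subproof (e : boset_of S) : f (sval e) * f (sval e) = f (sval e).
Proof. by rewrite -fM boset_of_idem. Qed.

Definition boset_map (e : boset_of S) : boset_of T :=
  exist (fun x : T => x * x = x) _ (boset_map_subproof e).

Lemma boset_map_morphism :
  @is_rsb_morphism (boset_of_rsb S) (boset_of_rsb T) boset_map.
Proof.
split.
- move=> e g h [bp egh]; split; last by rewrite /= -fM egh.
  by case: bp => [[]|[]] bp; rewrite /= /basic_pair -!fM bp;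
    [left; left|left; right|right; left|right; right].
- move=> e g h /(sandwichE _ _ _ (@regular_star_regular S)) [h1 h2 h3].
  apply/(sandwichE _ _ _ (@regular_star_regular T)).
  by rewrite /= -!fM h1 h2 h3.
- by move=> e; apply: sig_inj; rewrite /= f_star.
Qed.

End StarHom.

Definition E_obj (P : projAlg) : rsBoset := boset_of_rsb (PG P).

(* The restriction to idempotents of
   [[p_1, ..., p_k]] |-> [[p_1 phi, ..., p_k phi]]; see E_map_pg2. *)
Definition E_map (P Q : projAlg) (phi : pa_hom P Q) :
    rsb_hom (E_obj P) (E_obj Q) :=
  exist _ (boset_map (pg_mapM phi))
    (boset_map_morphism (pg_mapM phi) (pg_map_star phi)).

Lemma E_map_pg2 (P Q : projAlg) (phi : pa_hom P Q) (e : E_obj P) (p q : P)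
    (pq : Frel p q) :
  sval e = pg2 pq -> sval (E_map phi e) = pg2 (map_Frel phi pq).
Proof.
by move=> eE; rewrite /= eE /pg2 pg_mapE; apply/pgclass_eq/pcong_refl/map_ppath.
Qed.

Definition E_functor : functor PA RSBS.
Proof.
apply: (@Functor PA RSBS E_obj E_map) => [P | P Q R phi psi].
- apply: rsb_homP => e; apply: sig_inj => /=.
  have [s [ps ->]] := pgclassP (sval e); rewrite pg_mapE; apply/pgclass_eq.
  by rewrite map_id; apply: pcong_refl.
- apply: rsb_homP => e; apply: sig_inj => /=.
  have [s [ps ->]] := pgclassP (sval e); rewrite !pg_mapE; apply/pgclass_eq.
  by rewrite -map_comp; apply/pcong_refl/(map_ppath (pa_comp phi psi)).
Defined.

Lemma partial_iso_sandwich (E F : partialMagma) (j : E -> F) e f g :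
  partial_iso j -> sandwich e f g <-> sandwich (j e) (j f) (j g).
Proof.
case=> -[k jK kK] jdot.
have Mj h : Mset e f h <-> Mset (j e) (j f) (j h).
  by rewrite /Mset -!jdot.
have Mlej h : Mset_le e f h g <-> Mset_le (j e) (j f) (j h) (j g).
  split=> -[[a [b [h1 h2 h3]]] [c [d [h4 h5 h6]]]].
    split; [exists (j a), (j b) | exists (j c), (j d)].
      by split; rewrite /le_r -?jdot.
    by split; rewrite /le_l -?jdot.
  split; [exists (k a), (k b) | exists (k c), (k d)].
    by split; rewrite /le_r ?jdot !kK.
  by split; rewrite /le_l ?jdot !kK.
split=> -[/Mj hM hle]; split=> // h.
  by rewrite -(kK h) => /Mj /hle /Mlej.
by move=> /Mj /hle /Mlej.
Qed.

Section ProjOf.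
Variable E : rsBoset.
Implicit Types e f g h p q r x : E.
Local Notation st := (@rsb_star E).

Lemma rsb_starK e : st (st e) = e. Proof. by have [_ ->] := rsbP E. Qed.

Lemma rsb_starM e f g : pdot e f g -> pdot (st f) (st e) (st g).
Proof. by have [_ _ h _] := rsbP E => /h []. Qed.

Lemma sandwich_star e f g : sandwich e f g -> sandwich (st f) (st e) (st g).
Proof.
have M e' f' h : Mset e' f' h -> Mset (st f') (st e') (st h).
  by case=> /rsb_starM ? /rsb_starM.
case=> /M hM hle; split=> // h /M; rewrite !rsb_starK => /hle.
case=> -[a [b [/rsb_starM h1 /rsb_starM h2 /rsb_starM h3]]].
case=> c [d [/rsb_starM h4 /rsb_starM h5 /rsb_starM h6]].
rewrite rsb_starK in h1 h4.
by split; [exists (st c), (st d) | exists (st a), (st b)].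
Qed.

(* the unique e with this property is the element e(p, q) *)
Definition is_epq p q e :=
  [/\ sandwich p q e, exists2 r, st r = r & pdot p e r &
      exists2 r, st r = r & pdot e q r].

Section Repr.
Variables (S : semigroupType) (j : E -> S).
Hypothesis regS : is_regular S.
Hypothesis jI : injective j.
Hypothesis jj : forall e, j e * j e = j e.
Hypothesis jsurj : forall a, a * a = a -> exists e, j e = a.
Hypothesis jdot : forall e f g,
  pdot e f g <-> basic_pair (j e) (j f) /\ j e * j f = j g.
Hypothesis jsand : forall e f g, sandwich e f g <->
  [/\ j g * j e = j g, j f * j g = j g & j e * j g * j f = j e * j f].

Lemma dotE e f g : pdot e f g -> j e * j f = j g.
Proof. by case/jdot. Qed.

Lemma dotl e f : j e * j f = j e -> pdot e f e.
Proof. by move=> h; apply/jdot; split=> //; left; left. Qed.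
Lemma dotr e f : j e * j f = j f -> pdot e f f.
Proof. by move=> h; apply/jdot; split=> //; left; right. Qed.
Lemma dotl' e f g : j f * j e = j e -> j e * j f = j g -> pdot e f g.
Proof. by move=> h h'; apply/jdot; split=> //; right; left. Qed.
Lemma dotr' e f g : j f * j e = j f -> j e * j f = j g -> pdot e f g.
Proof. by move=> h h'; apply/jdot; split=> //; right; right. Qed.

Lemma starl e f : j e * j f = j e -> j (st f) * j (st e) = j (st e).
Proof. by move=> /dotl /rsb_starM /dotE. Qed.
Lemma starr e f : j e * j f = j f -> j (st f) * j (st e) = j (st f).
Proof. by move=> /dotr /rsb_starM /dotE. Qed.

(* Two projections that are R-related (or L-related) are equal *)
Lemma proj_R_eq p q : st p = p -> st q = q ->
  j p * j q = j q -> j q * j p = j p -> p = q.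
Proof.
move=> pp qq h1 /starr; rewrite pp qq => h2; apply: jI; rewrite -h1.
by rewrite h2.
Qed.

Lemma proj_L_eq p q : st p = p -> st q = q ->
  j p * j q = j p -> j q * j p = j q -> p = q.
Proof.
move=> pp qq /starl + h2; rewrite pp qq h2 => h1; apply: jI.
by rewrite -h1.
Qed.

(* every idempotent is R-related to a projection and L-related to one *)
Lemma proj_R e : exists2 s, st s = s & j s * j e = j e /\ j e * j s = j s.
Proof.
have [_ _ _ /(_ e)[s [t [[h1 h2] _ _ [h3 h4] _]]]] := rsbP E.
move/dotE in h1; move/dotE in h2; move/dotE in h3; move/dotE in h4.
exists s => //.
have h1' := starr h1; have h2' := starr h2.
apply: jI.
have ss : j s * j (st s) = j s by rewrite -{1}h3 -mulgA h1' h3.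
have ss' : j s * j (st s) = j (st s).
  by have := starl ss; rewrite rsb_starK.
by rewrite -ss' ss.
Qed.

Lemma proj_L e : exists2 t, st t = t & j e * j t = j e /\ j t * j e = j t.
Proof.
have [s ss [h1 h2]] := proj_R (st e); exists s => //.
have := starr h1; have := starr h2; rewrite ss rsb_starK => h3 h4.
by split.
Qed.

Lemma epq_exists p q : st p = p -> st q = q -> exists e, is_epq p q e.
Proof.
move=> pp qq.
have [a [aI Ia]] := regular_inverse (j p * j q) regS.
have [u uE] : exists u, j u = j p * j q * a by apply: jsurj; rewrite mulgA aI.
have [v vE] : exists v, j v = a * (j p * j q) by apply: jsurj; rewrite mulgA Ia.
have [s ss [su us]] := proj_R u; have [t tt [vt tv]] := proj_L v.
have ps : j p * j s = j s by rewrite -us uE !mulgA jj.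
have tq : j t * j q = j t by rewrite -tv vE -!mulgA jj.
have sp : j s * j p = j s by have := starr ps; rewrite ss pp.
have qt : j q * j t = j t by have := starl tq; rewrite tt qq.
have sa : j s * (j p * j q) = j p * j q by rewrite -[in LHS]aI -uE mulgA su uE aI.
have at_ : j p * j q * j t = j p * j q.
  by rewrite -[in LHS]aI -(mulgA _ a) -vE -mulgA vt vE mulgA aI.
pose x := j t * a * j s.
have ax : j p * j q * x = j s by rewrite /x !mulgA at_ -uE us.
have xa : x * (j p * j q) = j t by rewrite /x -!mulgA sa -vE tv.
have xp : x * j p = x by rewrite /x -mulgA sp.
have qx : j q * x = x by rewrite /x !mulgA qt.
have xx : x * x = x.
  by rewrite -{1}xp -{2}qx mulgA -(mulgA x) xa /x !mulgA jj.
have [e eE] := jsurj xx; exists e; rewrite -eE in ax xa xp qx.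
have pe : j p * j e = j s by rewrite -{1}qx mulgA.
have eq_ : j e * j q = j t by rewrite -{1}xp -mulgA.
split.
- by apply/jsand; split=> //; rewrite pe -sa mulgA sp.
- by exists s => //; apply: dotr'.
- by exists t => //; apply: dotl'.
Qed.

Lemma epq_mul p q e : is_epq p q e ->
  [/\ j e * j p = j e, j q * j e = j e & j p * j e * j q = j p * j q].
Proof. by case=> /jsand. Qed.

Lemma epq_R p q e s : is_epq p q e -> pdot p e s ->
  j p * j q * j e = j s /\ j s * (j p * j q) = j p * j q.
Proof.
move=> he /dotE ps; have [ep qe peq] := epq_mul he.
by split; rewrite -ps -mulgA ?qe // (mulgA (j e)) ep mulgA.
Qed.

Lemma epq_L p q e t : is_epq p q e -> pdot e q t ->
  j e * (j p * j q) = j t /\ j p * j q * j t = j p * j q.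
Proof.
move=> he /dotE eq_; have [ep qe peq] := epq_mul he.
by split; rewrite -eq_ mulgA ?ep // -!mulgA (mulgA (j q)) qe mulgA.
Qed.

Lemma epq_idem p q e s t : is_epq p q e -> pdot p e s -> pdot e q t ->
  [/\ j e * j s = j e, j s * j e = j s, j e * j t = j t & j t * j e = j e].
Proof.
move=> he /dotE ps /dotE eq_; have [ep qe _] := epq_mul he.
split; rewrite -?ps -?eq_.
- by rewrite mulgA ep jj.
- by rewrite -mulgA jj.
- by rewrite mulgA jj.
- by rewrite -mulgA qe jj.
Qed.

Lemma epq_unique p q e e' : is_epq p q e -> is_epq p q e' -> e = e'.
Proof.
move=> h h'; have [_ [s ss ps] [t tt et]] := h.
have [_ [s' ss' ps'] [t' tt' et']] := h'.
have [a1 a2] := epq_R h ps; have [b1 b2] := epq_R h' ps'.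
have [a3 a4] := epq_L h et; have [b3 b4] := epq_L h' et'.
have sE : s = s'.
  by apply: proj_R_eq => //; [rewrite -b1 mulgA a2 | rewrite -a1 mulgA b2].
have tE : t = t'.
  by apply: proj_L_eq => //; [rewrite -a3 -mulgA b4 | rewrite -b3 -mulgA a4].
subst s' t'.
have [c1 c2 c3 c4] := epq_idem h ps et; have [d1 d2 d3 d4] := epq_idem h' ps' et'.
apply: jI.
have <- : j e * j e' = j e by rewrite -{1}c1 -mulgA d2.
by rewrite -[in LHS]d4 mulgA c3.
Qed.

Lemma epq_star p q e : st p = p -> st q = q -> is_epq p q e -> is_epq q p (st e).
Proof.
move=> pp qq [/sandwich_star + [s ss ps] [t tt et]]; rewrite pp qq.
have := rsb_starM ps; have := rsb_starM et; rewrite pp qq ss tt => ? ? ?.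
by split=> //; [exists t|exists s].
Qed.

(* [s] is q theta_p for projections p, q *)
Definition is_theta p q s := exists e, is_epq p q e /\ pdot p e s.

Lemma is_theta_star p q s : is_theta p q s -> st s = s.
Proof.
case=> e [[_ [r rr /dotE r1] _] /dotE s1].
by have -> : s = r by apply: jI; rewrite -r1.
Qed.

Lemma theta_facts p q s t : st p = p -> st q = q ->
    is_theta p q s -> is_theta q p t -> exists x,
  [/\ is_epq p q x, [/\ j x * j p = j x, j q * j x = j x & j p * j x = j s],
      [/\ j x * j q = j t, j p * j q * j x = j s & j x * (j p * j q) = j t],
      [/\ j s * (j p * j q) = j p * j q & j p * j q * j t = j p * j q] &
      [/\ j x * j s = j x, j s * j x = j s, j x * j t = j t & j t * j x = j x]].
Proof.
move=> pp qq [x [hx ps]] [y [hy qt]].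
have yE := epq_unique hy (epq_star pp qq hx); subst y.
have tt : st t = t by apply: (@is_theta_star q p); exists (st x).
have xt : pdot x q t by have := rsb_starM qt; rewrite rsb_starK qq tt.
exists x; have [? ? _] := epq_mul hx.
have [? ?] := epq_R hx ps; have [? ?] := epq_L hx xt.
by have [? ? ? ?] := epq_idem hx ps xt; split=> //; split=> //; apply: dotE.
Qed.

Lemma is_theta_ex p q : st p = p -> st q = q -> exists s, is_theta p q s.
Proof.
move=> pp qq; have [e he] := epq_exists pp qq.
by have [_ [s _ ps] _] := he; exists s, e.
Qed.

Definition Rrel (a b : S) := (exists x : S, a * x = b) /\ (exists y : S, b * y = a).

Lemma RrelC a b : Rrel a b -> Rrel b a. Proof. by case. Qed.
Lemma Rrel_trans b a c : Rrel a b -> Rrel b c -> Rrel a c.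
Proof.
move=> [[x <-] [y yE]] [[z <-] [w wE]]; split.
  by exists (x * z); rewrite mulgA.
by exists (w * y); rewrite mulgA wE.
Qed.
Lemma Rrel_mul c a b : Rrel a b -> Rrel (c * a) (c * b).
Proof.
by move=> [[x <-] [y yE]]; split; [exists x|exists y]; rewrite -mulgA ?yE.
Qed.

Lemma Rrel_proj p q : st p = p -> st q = q -> Rrel (j p) (j q) -> p = q.
Proof.
move=> pp qq [[x xE] [y yE]]; apply: proj_R_eq => //.
  by rewrite -xE mulgA jj.
by rewrite -yE mulgA jj.
Qed.

Lemma theta_R p q s : st p = p -> st q = q -> is_theta p q s ->
  Rrel (j s) (j p * j q).
Proof.
move=> pp qq h; have [t ht] := is_theta_ex qq pp.
have [x [_ _ [_ h1 _] [h2 _] _]] := theta_facts pp qq h ht.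
by split; [exists (j p * j q)|exists (j x)].
Qed.

Lemma theta_le p q s : st p = p -> st q = q -> is_theta p q s ->
  j p * j s = j s /\ j s * j p = j s.
Proof.
move=> pp qq h; have [t ht] := is_theta_ex qq pp.
have [x [_ [_ _ h1] _ _ _]] := theta_facts pp qq h ht.
have ps : j p * j s = j s by rewrite -h1 mulgA jj.
by split=> //; have := starr ps; rewrite pp (is_theta_star h).
Qed.

Lemma is_theta_unique p q s s' : st p = p -> st q = q ->
  is_theta p q s -> is_theta p q s' -> s = s'.
Proof.
move=> pp qq h h'; apply: Rrel_proj; [exact: is_theta_star h | exact: is_theta_star h'|].
apply: Rrel_trans (theta_R pp qq h) _; exact/RrelC/theta_R.
Qed.

(* the key step: p theta_q theta_p fixes the projections below q theta_p *)
Lemma theta_conj p q s g k : st p = p -> st q = q -> is_theta p q s ->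
  st g = g -> j s * j g = j g -> is_theta q g k -> is_theta p k g.
Proof.
move=> pp qq hs gg sg hk; have [t ht] := is_theta_ex qq pp.
have ss := is_theta_star hs; have tt := is_theta_star ht.
have [x [hx [xp qx px] [xq pqx xpq] [spq pqt] [xs sx xt tx]]] :=
  theta_facts pp qq hs ht.
have gs : j g * j s = j g by have := starr sg; rewrite ss gg.
have gx : j g * j x = j g by rewrite -gs -mulgA sx.
have gp : j g * j p = j g.
  by have [_ sp] := theta_le pp qq hs; rewrite -gs -mulgA sp.
have [y yE] : exists y, j y = j x * j g.
  by apply: jsurj; rewrite -mulgA (mulgA (j g)) gx jj.
have yx : j y * j x = j y by rewrite yE -mulgA gx.
have xy : j x * j y = j y by rewrite yE mulgA jj.
have ty : j t * j y = j y by rewrite yE mulgA tx.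
have gy : j g * j y = j g by rewrite yE mulgA gx jj.
have ysE : j (st y) = j g * j (st x).
  have : pdot x g y by apply: dotr'; rewrite ?gx // yE.
  by move/rsb_starM/dotE; rewrite gg.
have [K KE] : exists K, j K = j y * j t.
  by apply: jsurj; rewrite -mulgA (mulgA (j t)) ty mulgA jj.
have xst : j (st x) * j t = j (st x).
  by have := starr tx; rewrite tt.
have txs : j t * j (st x) = j t by have := starr xt; rewrite tt.
have sxs : j s * j (st x) = j (st x) by have := starl xs; rewrite ss.
have xss : j (st x) * j s = j s by have := starl sx; rewrite ss.
have xK : j (st x) * j K = j (st y).
  have [_ _ _ /(_ x)[s' [t' [[h1 h2] [h3 h4] [h5 h6] [h7 h8] h]]]] := rsbP E.
  have t'E : j s' = j t.
    have e1 : j s' * j t = j t by rewrite -xt mulgA (dotE h1).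
    have e2 : j s' * j t = j s' by rewrite -(dotE h7) -mulgA xst.
    by rewrite -e2.
  have s'E : j t' = j s.
    have e1 : j t' * j s = j t' by rewrite -(dotE h6) -mulgA xs.
    have e2 : j t' * j s = j s by rewrite -xss mulgA (dotE h4).
    by rewrite -e1.
  have [gs' [tg [z [/dotE a1 /dotE a2 /dotE a3 /dotE a4]]]] :=
    h y (dotl yx) (dotr xy).
  rewrite KE -t'E a1 a3 -a4 -a2 s'E yE ysE mulgA sx.
  by rewrite sg.
have KK : st K = K.
  have Ky : j K * j y = j y by rewrite KE -mulgA ty jj.
  have yK : j y * j K = j K by rewrite KE mulgA jj.
  have ysKs : j (st y) * j (st K) = j (st y) by have := starr Ky.
  have Ksys : j (st K) * j (st y) = j (st K) by have := starr yK.
  have Kys : j K * j (st y) = j K.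
    by rewrite -xK mulgA KE -(mulgA (j y)) txs -KE jj.
  have ysK : j (st y) * j K = j (st y) by rewrite -xK -mulgA jj.
  have KsK : j (st K) * j K = j (st K) by rewrite -Ksys -mulgA ysK.
  have := starl KsK; rewrite rsb_starK KsK => KE'.
  by apply: jI.
have KpqE : j K = j x * j g * (j p * j q).
  by rewrite KE yE -xpq -!mulgA (mulgA (j g)) gx.
have {}KpqE : j K = j x * (j g * j q).
  by rewrite KpqE -!mulgA (mulgA (j g) (j p)) gp.
have kk := is_theta_star hk.
have kK : k = K.
  have [k' hk'] := is_theta_ex gg qq.
  have [w [_ _ [_ _ gqk] [_ kgq] _]] := theta_facts gg qq hk' hk.
  have gqK : j g * j q * j K = j g * j q.
    by rewrite KpqE -mulgA (mulgA (j q)) qx !mulgA gx jj.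
  by apply: proj_L_eq => //; [rewrite -gqk -!mulgA | rewrite KpqE -mulgA];
    rewrite ?kgq // (mulgA (j g)) gqK.
have [g' hg'] := is_theta_ex pp kk.
suff -> : g = g' by [].
apply: Rrel_proj => //; first exact: is_theta_star hg'.
apply: Rrel_trans (RrelC (theta_R pp kk hg')).
rewrite kK KpqE mulgA px mulgA sg.
by split; [exists (j q) | exists (j x); rewrite -mulgA qx].
Qed.

Section ThetaLaws.
Variable th : E -> E -> E.
Hypothesis thP : forall p q, st p = p -> st q = q -> is_theta p q (th p q).

Lemma th_star p q : st p = p -> st q = q -> st (th p q) = th p q.
Proof. by move=> pp qq; apply: is_theta_star (thP pp qq). Qed.

Lemma thR p q : st p = p -> st q = q -> Rrel (j (th p q)) (j p * j q).
Proof. by move=> pp qq; apply: theta_R (thP pp qq). Qed.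

Lemma thR2 p q (a : S) : st p = p -> st q = q -> Rrel (j q) a ->
  Rrel (j (th p q)) (j p * a).
Proof. by move=> pp qq qa; apply: Rrel_trans (thR pp qq) (Rrel_mul _ qa). Qed.

Lemma Rrel_th p q r : st p = p -> st q = q -> st r = r ->
  Rrel (j r) (j p * j q) -> th p q = r.
Proof.
move=> pp qq rr h; apply: Rrel_proj => //; first exact: th_star.
exact: Rrel_trans (thR pp qq) (RrelC h).
Qed.

Lemma Rrel_refl a : Rrel (j a) (j a).
Proof. by split; exists (j a); rewrite jj. Qed.

Lemma th_id p : st p = p -> th p p = p.
Proof. by move=> pp; apply: Rrel_th => //; rewrite jj; apply: Rrel_refl. Qed.

Lemma thK p x : st p = p -> st x = x -> th p (th p x) = th p x.
Proof.
move=> pp xx; have h := th_star pp xx; apply: Rrel_th => //.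
have [-> _] := theta_le pp xx (thP pp xx); exact: Rrel_refl.
Qed.

(* q * (q theta_p) and q * p are equal since (q theta_p) is L-related to q p *)
Lemma th_mul p q : st p = p -> st q = q ->
  j q * j p * j (th p q) = j q * j p /\ j q * j p * j (th p q) = j q * j (th p q).
Proof.
move=> pp qq; have [ps _] := theta_le pp qq (thP pp qq).
have [x [_ _ _ [_ h] _]] := theta_facts qq pp (thP qq pp) (thP pp qq).
by split; rewrite // -mulgA ps.
Qed.

Lemma th_sym p q : st p = p -> st q = q -> th p (th q p) = th p q.
Proof.
move=> pp qq; have h := th_star qq pp; apply: Rrel_th => //; first exact: th_star.
by have [e1 <-] := th_mul qq pp; rewrite e1; apply: thR.
Qed.

Lemma th_conj p q x : st p = p -> st q = q -> st x = x ->
  th p (th q (th p x)) = th (th p q) x.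
Proof.
move=> pp qq xx.
have hs := thP pp qq; have ss := th_star pp qq; set s := th p q in hs ss *.
have hg := thP ss xx; have gg := th_star ss xx.
have [sg _] := theta_le ss xx hg; set g := th s x in hg gg sg *.
have px := th_star pp xx.
have E1 : th q (th p x) = th q g.
  apply: Rrel_proj; [exact: th_star|exact: th_star|].
  apply: Rrel_trans (thR2 qq px (thR pp xx)) _.
  have [e1 e2] := th_mul pp qq.
  rewrite mulgA -e1 e2 -mulgA; apply: RrelC.
  exact: thR2 qq gg (thR ss xx).
rewrite E1; apply: (is_theta_unique pp) (thP pp _) _; rewrite ?th_star //.
apply: theta_conj hs gg sg (thP qq gg) => //.
Qed.

Lemma th_KK p q x : st p = p -> st q = q -> st x = x ->
  th q (th p (th q (th p x))) = th q (th p x).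
Proof.
move=> pp qq xx; rewrite (th_conj pp qq xx).
have ss := th_star pp qq; have px := th_star pp xx.
apply: Rrel_th; rewrite ?th_star //.
apply: Rrel_trans (thR2 qq px (thR pp xx)) _.
have [e1 e2] := th_mul pp qq.
by rewrite mulgA -e1 e2 -mulgA; apply: RrelC; apply: Rrel_mul; apply: thR.
Qed.

End ThetaLaws.
End Repr.

Lemma rsb_repr : exists (S : semigroupType) (j : E -> S),
  [/\ is_regular S, injective j /\ (forall e, j e * j e = j e),
      forall a, a * a = a -> exists e, j e = a,
      forall e f g, pdot e f g <-> basic_pair (j e) (j f) /\ j e * j f = j g &
      forall e f g, sandwich e f g <->
       [/\ j g * j e = j g, j f * j g = j g & j e * j g * j f = j e * j f]].
Proof.
have [[S [j [regS ji]]] _ _ _] := rsbP E; exists S, (fun e => sval (j e)).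
have [[k jK kK] jdot] := ji; split=> //.
- split=> [e f /sig_inj|e]; first exact: (can_inj jK).
  exact: boset_of_idem.
- by move=> a /boset_ofP[e <-]; exists (k e); rewrite kK.
- by move=> e f g; rewrite -(sandwichE _ _ _ regS); apply: partial_iso_sandwich.
Qed.

Lemma epq_ex p q : st p = p -> st q = q -> exists e, is_epq p q e.
Proof.
move=> pp qq; have [S [j [h1 [h2 h3] h4 h5 h6]]] := rsb_repr.
exact: (epq_exists h1 h2 h3 h4 h5 h6).
Qed.

Lemma epq_uniq p q e e' : is_epq p q e -> is_epq p q e' -> e = e'.
Proof.
have [S [j [h1 [h2 h3] h4 h5 h6]]] := rsb_repr.
exact: (epq_unique h2 h3 h5 h6).
Qed.

Lemma pdot_fun e f g g' : pdot e f g -> pdot e f g' -> g = g'.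
Proof.
have [S [j [h1 [h2 h3] h4 h5 h6]]] := rsb_repr.
by move=> /h5[_ r1] /h5[_ r2]; apply: h2; rewrite -r1.
Qed.

Definition proj := {p : E | st p = p}.

Definition epq (p q : proj) : E := sval (cid (epq_ex (svalP p) (svalP q))).

Lemma epqP (p q : proj) : is_epq (sval p) (sval q) (epq p q).
Proof. exact: (svalP (cid _)). Qed.

Fact proj_theta_ex (p q : proj) : exists r : proj, pdot (sval p) (epq p q) (sval r).
Proof.
have [_ [r rr pr] _] := epqP p q.
by exists (exist (fun x => st x = x) r rr).
Qed.

(* q theta_p = p e(p, q) *)
Definition proj_theta (p q : proj) : proj := sval (cid (proj_theta_ex p q)).

Lemma proj_thetaP (p q : proj) : pdot (sval p) (epq p q) (sval (proj_theta p q)).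
Proof. exact: (svalP (cid (proj_theta_ex p q))). Qed.

Lemma proj_theta_unique (p q r : proj) e :
  is_epq (sval p) (sval q) e -> pdot (sval p) e (sval r) -> proj_theta p q = r.
Proof.
move=> he hr; apply: sig_inj; apply: pdot_fun (proj_thetaP p q) _.
by rewrite (epq_uniq (epqP p q) he).
Qed.

(* proj_theta extended by an arbitrary value outside proj *)
Definition ext_theta (p q : E) : E :=
  match pselect (st p = p), pselect (st q = q) with
  | left pp, left qq => sval (proj_theta (exist _ p pp) (exist _ q qq))
  | _, _ => p
  end.

Lemma ext_thetaE (p q : proj) : sval (proj_theta p q) = ext_theta (sval p) (sval q).
Proof.
case: p q => p pp [q qq]; rewrite /ext_theta /=.
case: pselect => // pp'; case: pselect => // qq'.
by rewrite (Prop_irrelevance pp' pp) (Prop_irrelevance qq' qq).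
Qed.

Lemma ext_thetaP p q : st p = p -> st q = q -> is_theta p q (ext_theta p q).
Proof.
move=> pp qq; pose p' : proj := exist _ p pp; pose q' : proj := exist _ q qq.
rewrite -(ext_thetaE p' q'); exists (epq p' q').
by split; [apply: (epqP p' q') | apply: (proj_thetaP p' q')].
Qed.

Definition P_obj : projAlg.
Proof.
apply: (@ProjAlg proj proj_theta) => [[p pp]|[p pp] [x xx]|[p pp] [q qq]|
  [p pp] [q qq] [x xx]|[p pp] [q qq] [x xx]]; apply: sig_inj;
  rewrite !ext_thetaE /=; have [S [j [h1 [h2 h3] h4 h5 h6]]] := rsb_repr.
- exact: (th_id h1 h2 h3 h4 h5 h6 ext_thetaP).
- exact: (thK h1 h2 h3 h4 h5 h6 ext_thetaP).
- exact: (th_sym h1 h2 h3 h4 h5 h6 ext_thetaP).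
- exact: (th_conj h1 h2 h3 h4 h5 h6 ext_thetaP).
- exact: (th_KK h1 h2 h3 h4 h5 h6 ext_thetaP).
Defined.

End ProjOf.

Section PMap.
Variables (E F : rsBoset) (phi : rsb_hom E F).

Fact P_map_subproof (p : P_obj E) : rsb_star (phi (sval p)) = phi (sval p).
Proof. by have [_ _ <-] := svalP phi; rewrite (svalP p). Qed.

Definition P_map_fun (p : P_obj E) : P_obj F :=
  exist (fun x : F => rsb_star x = x) _ (P_map_subproof p).

Fact P_map_morphism : is_pa_morphism P_map_fun.
Proof.
move=> q p; apply/esym; have [f1 f2 f3] := svalP phi.
have [h [r rr pr] [r' rr' qr]] := epqP p q.
apply: (@proj_theta_unique _ _ _ _ (phi (epq p q))) => /=.
  split; first exact: f2.
    by exists (phi r); [rewrite -f3 rr | apply: f1].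
  by exists (phi r'); [rewrite -f3 rr' | apply: f1].
exact/f1/proj_thetaP.
Qed.

Definition P_map : pa_hom (P_obj E) (P_obj F) := exist _ _ P_map_morphism.

End PMap.

Definition P_functor : functor RSBS PA.
Proof.
apply: (@Functor RSBS PA P_obj P_map) => [E | E F G phi psi];
  by apply: pa_homP => p; apply: sig_inj.
Defined.

(* The map P -> P(E(P)), p |-> [[p]], through which p is identified with [[p]]:
   an element of P(E(P)) is a projection of the boset of idempotents of PG(P). *)
Definition is_canonical_identification (P : projAlg)
    (f : pa_hom P (P_obj (E_obj P))) :=
  forall p : P, sval (sval (f p)) = pg1 p.

(* Main.v *)
Require Import Defs.
From mathcomp Require Import all_boot.
From mathcomp Require Import boolp.

(** The theorem holds because a regular *-boset is a coordinate structure over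
    its projections.  Each idempotent e is R-related to exactly one projection
    p and L-related to exactly one projection q; the pair (p, q) determines e,
    the pairs that occur are exactly those with p F q in the projection algebra
    of E ([coords_of_Frel], [Frel_of_coords]), and the star swaps p and q.

    The partial product can be read off from coordinates as well
    ([pdot_coords]).  Let e = (p, q) and f = (r, s).  The order relations
    between e and f are order relations between their coordinates, so the cases
    ef = e and ef = f are clear.  If fe = e, then ef is R-related to p, and its
    right coordinate is q theta_r theta_s; the case fe = f follows by duality.
    The value q theta_r theta_s is the heart of the proof.  It would be
    immediate in a regular *-semigroup, where (ef)*(ef) = s r q r s, but E is
    only known to consist of the idempotents of some regular semigroup, whose
    other elements carry no star.  The last axiom of regular *-bosets makes up
    for this ([star_mul_below]).

    Hence two regular *-bosets are isomorphic as soon as their projection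
    algebras are.  For the first isomorphism of functors, the projections of
    PG(P) are the classes [[p]], and e([[p]], [[q]]) is [[q]][[p]], so that
    [[q]] theta_[[p]] is [[p]][[q]][[p]] = [[q theta_p]] ([pg_proj_morphism]).
    For the second, take P to be the projection algebra of E: the idempotent
    [[p, q]] of PG(P) has coordinates ([[p]], [[q]]), so the map sending the
    element of E with coordinates (p, q) to [[p, q]] transports the product of
    E, which is given by the same formula on both sides, and is bijective by
    the description of the pairs that occur ([boset_coord_partial_iso]).  It is
    natural because morphisms preserve coordinates ([map_coords]). *)

Set Implicit Arguments.
Unset Strict Implicit.
Unset Printing Implicit Defensive.

Local Open Scope group_scope.

(** * Coordinates of idempotents *)

(** That is, p R e L q in terms of the Green relations. *)
Definition coords (E : rsBoset) (e : E) (p q : P_obj E) :=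
  [/\ pdot (sval p) e e, pdot e (sval p) (sval p),
      pdot e (sval q) e & pdot (sval q) e (sval q)].

(** The multiplication table in coordinates of the basic pairs
    e = (p, q), f = (r, s), with product (u, v).  The alternatives are, in this
    order, ef = e, ef = f, fe = e and fe = f. *)
Definition coord_mul (A : projAlg) (p q r s u v : A) :=
  [\/ q \th s = q /\ (u = p /\ v = q),
      r \th p = r /\ (u = r /\ v = s),
      p \th r = p /\ (u = p /\ v = q \th r \th s) |
      s \th q = s /\ (u = r \th q \th p /\ v = s)].

(** A fixed regular semigroup whose idempotents are the elements of E.  The
    arguments about the partial product of E pass through products that are
    undefined in E. *)
Definition rep (E : rsBoset) : semigroupType := sval (cid (rsb_repr E)).
Definition rep_emb (E : rsBoset) : E -> rep E :=
  sval (cid (svalP (cid (rsb_repr E)))).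

Lemma repP (E : rsBoset) (j := @rep_emb E) :
  [/\ is_regular (rep E), injective j /\ (forall e, j e * j e = j e),
      forall a, a * a = a -> exists e, j e = a,
      forall e f g, pdot e f g <-> basic_pair (j e) (j f) /\ j e * j f = j g &
      forall e f g, sandwich e f g <->
       [/\ j g * j e = j g, j f * j g = j g & j e * j g * j f = j e * j f]].
Proof. exact: svalP (cid (svalP (cid (rsb_repr E)))). Qed.

Section Coordinates.
Variable E : rsBoset.
Local Notation j := (@rep_emb E).

Let regS : is_regular (rep E). Proof. by have [] := repP E. Qed.
Let jI : injective j. Proof. by have [_ []] := repP E. Qed.
Let jj e : j e * j e = j e. Proof. by have [_ []] := repP E. Qed.
Let jsurj a : a * a = a -> exists e, j e = a.
Proof. by have [_ _ h _ _] := repP E; apply: h. Qed.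
Let jdot e f g : pdot e f g <-> basic_pair (j e) (j f) /\ j e * j f = j g.
Proof. by have [_ _ _ h _] := repP E; apply: h. Qed.
Let jsand e f g : sandwich e f g <->
  [/\ j g * j e = j g, j f * j g = j g & j e * j g * j f = j e * j f].
Proof. by have [_ _ _ _ h] := repP E; apply: h. Qed.

Implicit Types (e f g : E) (p q r s u v : P_obj E).
Local Notation st := (@rsb_star E).
Local Notation jp p := (j (sval p)).

Lemma is_theta_theta p q : is_theta (sval p) (sval q) (sval (q \th p)).
Proof. by exists (epq p q); split; [exact: epqP | exact: proj_thetaP]. Qed.

Lemma coordsE e p q : coords e p q <->
  [/\ jp p * j e = j e, j e * jp p = jp p, j e * jp q = j e & jp q * j e = jp q].
Proof.
split; first by case=> /(dotE jdot) ? /(dotE jdot) ? /(dotE jdot) ? /(dotE jdot).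
by case=> *; split; by [apply: (dotl jdot) | apply: (dotr jdot)].
Qed.

Lemma coords_ex e : exists p q, coords e p q.
Proof.
have [p pp [h1 h2]] := proj_R jI jdot e; have [q qq [h3 h4]] := proj_L jI jdot e.
pose mk x (xx : st x = x) : P_obj E := exist (fun x => st x = x) x xx.
by exists (mk p pp), (mk q qq); apply/coordsE.
Qed.

Lemma coords_star e p q : coords e p q -> coords (st e) q p.
Proof.
case=> /rsb_starM + /rsb_starM + /rsb_starM + /rsb_starM.
by rewrite (svalP p) (svalP q).
Qed.

Lemma proj_Rrel p q : Rrel (jp p) (jp q) -> p = q.
Proof. by move=> /(Rrel_proj jI jj jdot (svalP p) (svalP q)) /sig_inj. Qed.

Lemma coords_R e p q : coords e p q -> Rrel (j e) (jp p).
Proof. by move=> /coordsE[? ? _ _]; split; [exists (jp p)|exists (j e)]. Qed.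

Lemma coords_uniq e p q p' q' : coords e p q -> coords e p' q' -> p = p' /\ q = q'.
Proof.
move=> h h'; split; apply: proj_Rrel.
  exact: Rrel_trans (RrelC (coords_R h)) (coords_R h').
exact: Rrel_trans (RrelC (coords_R (coords_star h))) (coords_R (coords_star h')).
Qed.

Lemma coords_inj e f p q : coords e p q -> coords f p q -> e = f.
Proof.
move=> /coordsE[e1 e2 e3 e4] /coordsE[f1 f2 f3 f4]; apply: jI.
have <- : j e * j f = j e by rewrite -{1}e3 -mulgA f4.
by rewrite -{1}f1 mulgA e2.
Qed.

Lemma proj_leE p r : p \th r = p <-> jp r * jp p = jp p.
Proof.
split=> [<-|h].
  by have [] := theta_le regS jI jj jsurj jdot jsand (svalP r) (svalP p)
    (is_theta_theta r p).
apply: proj_Rrel; rewrite -[in X in Rrel _ X]h.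
exact: (theta_R regS jI jj jsurj jdot jsand (svalP r) (svalP p) (is_theta_theta r p)).
Qed.

(** * Products in coordinates *)

Lemma theta_Rrel p q : Rrel (jp (q \th p)) (jp p * jp q).
Proof.
exact: (theta_R regS jI jj jsurj jdot jsand (svalP p) (svalP q) (is_theta_theta p q)).
Qed.

(** The dual of [theta_Rrel]: q theta_p is L-related to the product qp. *)
Lemma theta_Lmul p q :
  jp q * jp p * jp (q \th p) = jp q * jp p /\
  exists a, a * (jp q * jp p) = jp (q \th p).
Proof.
have [x [_ _ [_ _ h] [_ h'] _]] := theta_facts jI jj jdot jsand (svalP q) (svalP p)
  (is_theta_theta q p) (is_theta_theta p q).
by split=> //; exists (j x).
Qed.

(** The idempotent is e(q, p): the projections q e(q, p) and e(q, p) p are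
    p theta_q and q theta_p, which are q and p when p F q. *)
Lemma coords_of_Frel p q : Frel p q -> exists e, coords e p q.
Proof.
move=> [pq qp].
have [x [_ [xq px qx] [xp _ _] _ _]] := theta_facts jI jj jdot jsand (svalP q)
  (svalP p) (is_theta_theta q p) (is_theta_theta p q).
by exists x; apply/coordsE; rewrite -qp in qx; rewrite -pq in xp.
Qed.

(** If f is R-related to s and L-related to r, then f = e(r, s) and so
    s theta_r = rf = r; the other half of F is obtained from f*. *)
Lemma Frel_of_coords e p q : coords e p q -> Frel p q.
Proof.
suff leF_coords f r s : coords f r s -> leF r s.
  by move=> h; split; [exact: leF_coords h | exact: leF_coords (coords_star h)].
move=> /coords_star; move: (st f) => {}f h; have [sf fs fr rf] := h.
move/coordsE: h => [h1 h2 h3 h4].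
apply: esym; apply: (@proj_theta_unique _ r s r f) => //; split; last 2 first.
- by exists (sval r) => //; exact: (svalP r).
- by exists (sval s) => //; exact: (svalP s).
by apply/jsand; rewrite h4.
Qed.

(** If h lies below the left coordinate r of f, the last axiom of regular
    *-bosets, taken at f and at g = hf, reads f* h = (s h f) f*.  The right-hand
    side is R-related to sh, hence to s (q theta_s), where q is the left
    coordinate of h. *)
Lemma star_mul_below f h r s q u : coords f r s -> coords h q u ->
  jp r * j h = j h -> j h * jp r = j h ->
  Rrel (j (st f) * j h) (jp (q \th s)).
Proof.
move=> hf hh rh hr; have [f1 f2 f3 f4] := (coordsE _ _ _).1 hf.
have [k1 k2 k3 k4] := (coordsE _ _ _).1 (coords_star hf).
have fh : j f * j h = j h by rewrite -rh mulgA f2.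
have [g gE] : exists g, j g = j h * j f.
  by apply: jsurj; rewrite -mulgA (mulgA (j f)) fh mulgA jj.
have gf : j g * j f = j g by rewrite gE -mulgA jj.
have fg : j f * j g = j g by rewrite gE mulgA fh.
(* the elements s and t provided by the axiom are the coordinates of f *)
have [_ _ _ /(_ f)[r' [s' [[/(dotE jdot) a1 /(dotE jdot) a2]
  [/(dotE jdot) b1 /(dotE jdot) b2] [/(dotE jdot) c1 /(dotE jdot) c2]
  [/(dotE jdot) d1 /(dotE jdot) d2] key]]]] := rsbP E.
have r'E : j r' = jp r.
  have e1 : j r' * jp r = jp r by rewrite -f2 mulgA a1.
  by rewrite -e1 -[in RHS]d1 -mulgA k3 d1.
have s'E : j s' = jp s.
  have e1 : j s' * jp s = jp s by rewrite -[in LHS]k2 mulgA b2 k2.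
  by rewrite -e1 -[in RHS]c2 -mulgA f3 c2.
have [gr [sg [x [/(dotE jdot) y1 /(dotE jdot) y2 /(dotE jdot) y3 /(dotE jdot) y4]]]] :=
  key g (dotl jdot gf) (dotr jdot fg).
have xE : j (st f) * j h = jp s * j h * j f * j (st f).
  have hE : j h = j gr by rewrite -y1 gE r'E -mulgA f2 hr.
  by rewrite [in LHS]hE y3 -y4 -y2 s'E gE !mulgA.
apply: (@Rrel_trans _ (jp s * j h)).
  split; last by exists (j f * j (st f)); rewrite xE !mulgA.
  exists (jp s * jp r); rewrite xE -!mulgA (mulgA _ (jp s)) k2.
  by rewrite (mulgA _ (jp s)) f3 f2 hr.
apply: (@Rrel_trans _ (jp s * jp q)); first exact/Rrel_mul/(coords_R hh).
exact/RrelC/theta_Rrel.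
Qed.

(** Since fe = e forces re = e, the element k = er is an idempotent below r with
    right coordinate q theta_r, and ef = kf.  The right coordinate of kf is the
    left coordinate of f* k*, so it is given by [star_mul_below]. *)
Lemma coords_mul_below e f g p q r s u v :
  coords e p q -> coords f r s -> coords g u v ->
  j f * j e = j e -> pdot e f g -> u = p /\ v = q \th r \th s.
Proof.
move=> he hf hg fe efg; have efE := dotE jdot efg.
have [f1 f2 f3 f4] := (coordsE _ _ _).1 hf.
have [e1 e2 e3 e4] := (coordsE _ _ _).1 he.
have re : jp r * j e = j e by rewrite -fe mulgA f1.
have ge : j g * j e = j e by rewrite -efE -mulgA fe jj.
split.
  apply: proj_Rrel; apply: Rrel_trans (RrelC (coords_R hg)) _.
  apply: Rrel_trans (coords_R he); split; first by exists (j e).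
  by exists (j f).
have [k kE] : exists k, j k = j e * jp r.
  by apply: jsurj; rewrite -mulgA (mulgA (jp r)) re mulgA jj.
have [p' [q' hk]] := coords_ex k.
have rk : jp r * j k = j k by rewrite kE mulgA re.
have kr : j k * jp r = j k by rewrite kE -mulgA jj.
have ks : j (st k) * jp r = j (st k) by have := starr jdot rk; rewrite (svalP r).
have sk : jp r * j (st k) = j (st k) by have := starl jdot kr; rewrite (svalP r).
have q'E : q' = q \th r.
  have [t1 [a t2]] := theta_Lmul r q.
  have [k1 k2 k3 k4] := (coordsE _ _ _).1 hk.
  apply: sig_inj; apply: (proj_L_eq jI jdot (svalP q') (svalP (q \th r))).
    have -> : jp q' = jp q' * j e * (jp q * jp r).
      by rewrite mulgA -(mulgA _ (j e)) e3 -mulgA -kE k4.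
    by rewrite -[LHS]mulgA t1.
  have tE : a * (jp q * j k) = jp (q \th r) by rewrite -t2 kE (mulgA (jp q)) e4.
  by rewrite -tE -!mulgA k3.
apply: proj_Rrel; apply: Rrel_trans (RrelC (coords_R (coords_star hg))) _.
have kfg : pdot k f g.
  apply/jdot; split; last by rewrite kE -mulgA f1.
  by right; left; rewrite kE mulgA fe.
rewrite -(dotE jdot (rsb_starM kfg)) -q'E.
exact: star_mul_below hf (coords_star hk) sk ks.
Qed.

Lemma le_l_coords e f p q r s : coords e p q -> coords f r s ->
  le_l e f <-> q \th s = q.
Proof.
move=> /coordsE[e1 e2 e3 e4] /coordsE[f1 f2 f3 f4]; split.
  move=> /(dotE jdot) ef; apply/proj_leE.
  have qs : jp q * jp s = jp q by rewrite -[in LHS]e4 -ef -!mulgA f3 ef.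
  by have := starl jdot qs; rewrite (svalP q) (svalP s).
move=> /proj_leE sq.
have qs : jp q * jp s = jp q.
  by have := starr jdot sq; rewrite (svalP q) (svalP s).
by apply: (dotl jdot); rewrite -[in LHS]e3 -qs -!mulgA f4 qs.
Qed.

Lemma le_r_coords e f p q r s : coords e p q -> coords f r s ->
  le_r e f <-> p \th r = p.
Proof.
move=> he hf; rewrite -(le_l_coords (coords_star he) (coords_star hf)) /le_r /le_l.
by split=> /rsb_starM; rewrite ?rsb_starK.
Qed.

Lemma pdot_basic e f : basic_pair (j e) (j f) -> exists g, pdot e f g.
Proof.
move=> b; have [g gE] := jsurj (basic_idem (jj e) (jj f) b).
by exists g; apply/jdot.
Qed.

(** Conversely to the computation of products, a product whose coordinates are
    the expected ones is the expected element, by [coords_inj]. *)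
Lemma pdot_coords e f g p q r s u v :
  coords e p q -> coords f r s -> coords g u v ->
  pdot e f g <-> coord_mul p q r s u v.
Proof.
move=> he hf hg; have he' := coords_star he; have hf' := coords_star hf.
have hg' := coords_star hg.
have lef := le_l_coords he hf; have rfe := le_r_coords hf he.
have ref := le_r_coords he hf; have lfe := le_l_coords hf he.
split=> [efg|[]].
- have efE := dotE jdot efg.
  have [[[ef|ef]|[fe|fe]] _] := (jdot e f g).1 efg.
  + apply: Or41; split; first by apply/lef; apply: (dotl jdot).
    have gE : g = e by apply: jI; rewrite -efE ef.
    by apply: coords_uniq hg _; rewrite gE.
  + apply: Or42; split; first by apply/rfe; apply: (dotr jdot).
    have gE : g = f by apply: jI; rewrite -efE ef.
    by apply: coords_uniq hg _; rewrite gE.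
  + apply: Or43; split; first by apply/ref; apply: (dotr jdot).
    exact: coords_mul_below he hf hg fe efg.
  + apply: Or44; split; first by apply/lfe; apply: (dotl jdot).
    have [-> ->] := coords_mul_below hf' he' hg' (starl jdot fe) (rsb_starM efg).
    by [].
- by case=> /lef ef [? ?]; subst u v; rewrite (coords_inj hg he).
- by case=> /rfe ef [? ?]; subst u v; rewrite (coords_inj hg hf).
- case=> /ref/(dotE jdot) fe [? ?]; subst u v.
  have [|k efk] := @pdot_basic e f; first by right; left.
  have [u [v hk]] := coords_ex k.
  have [? ?] := coords_mul_below he hf hk fe efk; subst u v.
  by rewrite (coords_inj hg hk).
- case=> /lfe/(dotE jdot) fe [? ?]; subst u v.
  have [|k efk] := @pdot_basic e f; first by right; right.
  have [u [v hk]] := coords_ex k.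
  have [? ?] := coords_mul_below hf' he' (coords_star hk) (starl jdot fe)
    (rsb_starM efk); subst u v.
  by rewrite (coords_inj hg hk).
Qed.

End Coordinates.

(** * Transport along maps of projections *)

Definition lcoord (E : rsBoset) (e : E) : P_obj E := sval (cid (coords_ex e)).
Definition rcoord (E : rsBoset) (e : E) : P_obj E :=
  sval (cid (svalP (cid (coords_ex e)))).

Lemma coordsP (E : rsBoset) (e : E) : coords e (lcoord e) (rcoord e).
Proof. exact: svalP (cid (svalP (cid (coords_ex e)))). Qed.

Lemma map_coords (E F : rsBoset) (phi : rsb_hom E F) (e : E) (p q : P_obj E) :
  coords e p q -> coords (phi e) (P_map phi p) (P_map phi q).
Proof. by have [phiM _ _] := svalP phi; case=> *; split; apply: phiM. Qed.

Lemma coord_mul_inj (A B : projAlg) (phi : pa_hom A B) (p q r s u v : A) :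
  injective phi ->
  coord_mul (phi p) (phi q) (phi r) (phi s) (phi u) (phi v) <->
  coord_mul p q r s u v.
Proof.
move=> phiI; split=> [|[] [h [-> ->]]].
- rewrite /coord_mul -!pa_homE.
  by case=> -[/phiI h [/phiI hu /phiI hv]];
    [apply: Or41|apply: Or42|apply: Or43|apply: Or44].
- by apply: Or41; rewrite -!pa_homE h.
- by apply: Or42; rewrite -!pa_homE h.
- by apply: Or43; rewrite -!pa_homE h.
- by apply: Or44; rewrite -!pa_homE h.
Qed.

(** * The projections of PG(P) *)

Section ProjectionsOfPG.
Variable P : projAlg.
Implicit Types p q : P.

Lemma pg1_inj : injective (@pg1 P).
Proof. by move=> p q /pgclass_eq /(pcong_head p). Qed.

Lemma pg2_inj p q p' q' (pq : Frel p q) (pq' : Frel p' q') :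
  pg2 pq = pg2 pq' -> p = p' /\ q = q'.
Proof.
by move=> /pgclass_eq h; split; [exact: pcong_head p h | exact: pcong_last p h].
Qed.

Lemma pg2_eq p q p' q' (pq : Frel p q) (pq' : Frel p' q') :
  p = p' -> q = q' -> pg2 pq = pg2 pq'.
Proof. by move=> ? ?; subst; congr pg2; apply: Prop_irrelevance. Qed.

Lemma pg2_idem p q (pq : Frel p q) : pg2 pq * pg2 pq = pg2 pq.
Proof. by apply/pg_idemP; exists p, q, pq. Qed.

Lemma pg2_xx p (pp : Frel p p) : pg2 pp = pg1 p.
Proof. exact/pgclass_eq/pcong_id. Qed.

Lemma pg1_idem p : pg1 p * pg1 p = pg1 p.
Proof. by rewrite -(pg2_xx (Frelxx p)) pg2_idem. Qed.

Lemma star_pg2 p q (pq : Frel p q) : star (pg2 pq) = pg2 (FrelC pq).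
Proof.
rewrite /star /= pg_starE; apply/pgclass_eq/pcong_refl.
by split=> //; apply: FrelC.
Qed.

Lemma star_pg1 p : star (pg1 p) = pg1 p.
Proof. by rewrite -(pg2_xx (Frelxx p)) star_pg2; apply: pg2_eq. Qed.

Lemma pg1M p q : pg1 p * pg1 q = pg2 (theta_FrelE p q).
Proof.
rewrite /mul /= pg_mulE; apply/pgclass_eq.
by rewrite /pprod /= !thetaK; apply: pcong_refl; split=> //; apply: theta_FrelE.
Qed.

Lemma pg1_mul_pg2 p q (pq : Frel p q) : pg1 p * pg2 pq = pg2 pq.
Proof.
rewrite /mul /= pg_mulE; apply/pgclass_eq.
rewrite (@pprod_cat _ [::] p p [:: q]); last by split=> //; apply: Frelxx.
apply: (@pcong_comp _ [:: p] [::]); first exact: pcong_id.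
by apply: pcong_refl; split.
Qed.

Lemma pg2_mul_pg1 p q (pq : Frel p q) : pg2 pq * pg1 p = pg1 p.
Proof.
rewrite /mul /= pg_mulE; apply/pgclass_eq.
rewrite (@pprod_cat _ [:: p] q p [::]); last by do !split; case: pq.
exact: pcong_inv.
Qed.

Lemma pg2_pg1 p q (pq : Frel p q) : pg2 pq * pg1 q = pg2 pq.
Proof.
by apply: (can_inj (@starK _)); rewrite starM star_pg1 !star_pg2 pg1_mul_pg2.
Qed.

Lemma pg1_pg2 p q (pq : Frel p q) : pg1 q * pg2 pq = pg1 q.
Proof.
by apply: (can_inj (@starK _)); rewrite starM star_pg1 !star_pg2 pg2_mul_pg1.
Qed.

Lemma pg2_mul_star p q (pq : Frel p q) : pg2 pq * star (pg2 pq) = pg1 p.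
Proof.
have qp : is_ppath [:: q; p] by split=> //; apply: FrelC.
rewrite star_pg2 /mul /= pg_mulE; apply/pgclass_eq.
rewrite (@pprod_cat _ [:: p] q q [:: p]); last first.
  by split=> //; split=> //; exact: Frelxx.
exact: (@pcong_cancel _ p [:: q]).
Qed.

Lemma pg1M3 p q : pg1 p * pg1 q * pg1 p = pg1 (q \th p).
Proof.
have -> : pg1 p * pg1 q * pg1 p = pg1 p * pg1 q * star (pg1 p * pg1 q).
  by rewrite starM !star_pg1 mulgA -(mulgA _ (pg1 q) (pg1 q)) pg1_idem.
by rewrite pg1M pg2_mul_star.
Qed.

End ProjectionsOfPG.

Section CanonicalIdentification.
Variable P : projAlg.
Local Notation mk := (fun C CC => exist (fun C : PG P => C * C = C) C CC).

Definition pg_proj_idem (p : P) : E_obj P := mk (pg1 p) (pg1_idem p).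

Fact pg_proj_star (p : P) : rsb_star (pg_proj_idem p) = pg_proj_idem p.
Proof. by apply: sig_inj; rewrite /= star_pg1. Qed.

Definition pg_proj (p : P) : P_obj (E_obj P) :=
  exist (fun x : E_obj P => rsb_star x = x) _ (pg_proj_star p).

(** The element e([[p]], [[q]]) is the product [[q]][[p]], an idempotent
    inverse of [[p]][[q]]. *)
Fact pg_proj_morphism : is_pa_morphism pg_proj.
Proof.
move=> q p; apply: esym.
have eE := pg1M q p.
pose e : E_obj P := mk (pg1 q * pg1 p) (etrans (congr1 (fun C => C * C) eE)
  (etrans (pg2_idem _) (esym eE))).
have ep : pg1 q * pg1 p * pg1 p = pg1 q * pg1 p by rewrite -mulgA pg1_idem.
have qe : pg1 q * (pg1 q * pg1 p) = pg1 q * pg1 p by rewrite mulgA pg1_idem.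
have pe : pdot (pg_proj_idem p) e (pg_proj_idem (q \th p)).
  by split; [right; right | rewrite /= mulgA pg1M3].
have eq : pdot e (pg_proj_idem q) (pg_proj_idem (p \th q)).
  by split; [right; left | rewrite /= pg1M3].
apply: (@proj_theta_unique _ (pg_proj p) (pg_proj q) _ e) => //; split.
- apply/(sandwichE _ _ _ (@regular_star_regular _)); split=> //=.
  by rewrite mulgA -(mulgA (pg1 p * pg1 q)) (pg1M p q) pg2_idem.
- by exists (pg_proj_idem (q \th p)) => //; apply: pg_proj_star.
- by exists (pg_proj_idem (p \th q)) => //; apply: pg_proj_star.
Qed.

Definition pg_proj_hom : pa_hom P (P_obj (E_obj P)) := exist _ _ pg_proj_morphism.

Lemma pg_proj_inj : injective pg_proj.
Proof. by move=> p q /(congr1 (fun x => sval (sval x))) /= /pg1_inj. Qed.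

(** An idempotent [[p, q]] equal to its star [[q, p]] has p = q, because
    congruent paths have the same source. *)
Lemma pg_proj_surj (x : P_obj (E_obj P)) : exists p, pg_proj p = x.
Proof.
case: x => e est; have [p [q [pq eE]]] := (pg_idemP (sval e)).1 (svalP e).
have /= := congr1 sval est; rewrite eE star_pg2 => /pg2_inj[? _]; subst q.
by exists p; do 2!apply: sig_inj; rewrite /= eE pg2_xx.
Qed.

Lemma coords_pg2 (e : E_obj P) p q (pq : Frel p q) :
  sval e = pg2 pq -> coords e (pg_proj p) (pg_proj q).
Proof.
move=> eE; split; [apply/le_rE|apply/le_rE|apply/le_lE|apply/le_lE]; rewrite /= eE.
- exact: pg1_mul_pg2.
- exact: pg2_mul_pg1.
- exact: pg2_pg1.
- exact: pg1_pg2.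
Qed.

End CanonicalIdentification.

(** * Isomorphisms *)

Lemma bij_pa_iso (A B : PA) (phi : pa_hom A B) :
  injective phi -> (forall b, exists a, phi a = b) -> @is_iso PA A B phi.
Proof.
move=> phiI phiS; pose psi b := sval (cid (phiS b)).
have psiK b : phi (psi b) = b by exact: svalP (cid (phiS b)).
have psiM : is_pa_morphism psi.
  by move=> b c; apply: phiI; rewrite pa_homE !psiK.
exists (exist _ psi psiM); split; apply: pa_homP => x; last exact: psiK.
by apply: phiI; apply: psiK.
Qed.

(** Sandwich sets are defined from the partial product alone, so isomorphisms
    of partial algebras preserve them. *)
Lemma partial_iso_rsb_morphism (E F : rsBoset) (phi : E -> F) :
  partial_iso phi -> (forall e, phi (rsb_star e) = rsb_star (phi e)) ->
  is_rsb_morphism phi.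
Proof.
move=> phi_iso phi_star; split=> // [e f g|e f g]; first by move/(phi_iso.2 e f g).
by move/(partial_iso_sandwich e f g phi_iso).
Qed.

Lemma partial_iso_is_iso (E F : RSBS) (phi : rsb_hom E F) :
  partial_iso phi -> @is_iso RSBS E F phi.
Proof.
move=> [[psi phiK psiK] phi_dot]; have [_ _ phi_star] := svalP phi.
have psi_mor : is_rsb_morphism psi.
  apply: partial_iso_rsb_morphism.
    split; first by exists phi.
    by move=> e f g; rewrite phi_dot !psiK.
  by move=> e; rewrite -[in LHS](psiK e) -phi_star phiK.
by exists (exist _ psi psi_mor); split; apply: rsb_homP => x;
  [exact: phiK | exact: psiK].
Qed.

Lemma naturally_isomorphic_sym (C D : category) (F G : functor C D) :
  naturally_isomorphic F G -> naturally_isomorphic G F.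
Proof.
move=> [eta [eta_nat eta_iso]]; pose inv X := sval (cid (eta_iso X)).
have invP X : Defs.comp (eta X) (inv X) = idm _ /\ Defs.comp (inv X) (eta X) = idm _.
  exact: svalP (cid (eta_iso X)).
exists inv; split=> [X Y f|X]; last by exists (eta X); have [] := invP X.
have [invX _] := invP Y; have [_ etaX] := invP X.
rewrite -[LHS]comp1m -etaX -Defs.compA; congr Defs.comp.
by rewrite Defs.compA -eta_nat -Defs.compA invX compm1.
Qed.

(** * The isomorphism between E and E(P(E)) *)

Section BosetCoordinateMap.
Variable E : rsBoset.

Definition boset_coord (e : E) : E_obj (P_obj E) :=
  exist (fun C : PG (P_obj E) => C * C = C) _
    (pg2_idem (Frel_of_coords (coordsP e))).

(** The coordinates of e and of its image correspond under the identification
    of P(E) with the projection algebra of PG(P(E)). *)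
Lemma boset_coord_coords e p q :
  coords e p q -> coords (boset_coord e) (pg_proj p) (pg_proj q).
Proof.
move=> /coords_uniq /(_ (coordsP e)) [-> ->].
exact: (@coords_pg2 _ (boset_coord e) _ _ _ erefl).
Qed.

Lemma boset_coord_inj : injective boset_coord.
Proof.
move=> e f /(congr1 sval)/pg2_inj[pE qE].
by apply: (coords_inj (coordsP e)); rewrite pE qE; apply: coordsP.
Qed.

Lemma boset_coord_surj x : exists e, boset_coord e = x.
Proof.
have [p [q [pq xE]]] := (pg_idemP (sval x)).1 (svalP x).
have [e he] := coords_of_Frel pq; exists e.
exact: coords_inj (boset_coord_coords he) (coords_pg2 xE).
Qed.

Lemma boset_coord_partial_iso : partial_iso boset_coord.
Proof.
split=> [|e f g].
  exists (fun x => sval (cid (boset_coord_surj x))) => x; last first.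
    exact: (svalP (cid (boset_coord_surj x))).
  apply: boset_coord_inj.
  exact: (svalP (cid (boset_coord_surj (boset_coord x)))).
have he := coordsP e; have hf := coordsP f; have hg := coordsP g.
rewrite (pdot_coords he hf hg).
rewrite (pdot_coords (boset_coord_coords he) (boset_coord_coords hf)
  (boset_coord_coords hg)).
apply: iff_sym; apply: (@coord_mul_inj _ _ (pg_proj_hom (P_obj E))).
exact: pg_proj_inj.
Qed.

Lemma boset_coord_star e : boset_coord (rsb_star e) = rsb_star (boset_coord e).
Proof.
have he := coordsP e.
exact: coords_inj (boset_coord_coords (coords_star he))
  (coords_star (boset_coord_coords he)).
Qed.

Definition boset_coord_hom : rsb_hom E (E_obj (P_obj E)) :=
  exist _ _ (partial_iso_rsb_morphism boset_coord_partial_iso boset_coord_star).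

End BosetCoordinateMap.

Lemma pg_proj_natural_iso :
  @is_natural_iso PA PA (functor_id PA) (functor_comp P_functor E_functor) pg_proj_hom.
Proof.
split=> [P Q phi|P].
  apply: pa_homP => p; do 2!apply: sig_inj; apply: esym.
  by rewrite /= /pg1 pg_mapE; apply/pgclass_eq/pcong_refl.
apply: (@bij_pa_iso P (P_obj (E_obj P)) (pg_proj_hom P)).
  exact: pg_proj_inj.
exact: pg_proj_surj.
Qed.

Lemma boset_coord_natural_iso :
  @is_natural_iso RSBS RSBS (functor_id RSBS) (functor_comp E_functor P_functor)
    boset_coord_hom.
Proof.
split=> [E F phi|E]; last first.
  exact: (@partial_iso_is_iso E (E_obj (P_obj E)) (boset_coord_hom E)
    (boset_coord_partial_iso E)).
apply: rsb_homP => e; apply: sig_inj; apply: esym.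
rewrite [LHS](@E_map_pg2 _ _ (P_map phi) (boset_coord e) _ _ _ erefl).
have [pE qE] := coords_uniq (map_coords (phi : rsb_hom E F) (coordsP e))
  (coordsP ((phi : rsb_hom E F) e)).
exact: pg2_eq.
Qed.

(** * The equivalence *)

Theorem theorem6p19 :
  [/\ exists eta : forall P : PA,
          hom (functor_id PA P) (functor_comp P_functor E_functor P),
        @is_natural_iso PA PA
          (functor_id PA) (functor_comp P_functor E_functor) eta /\
        (forall P : projAlg, is_canonical_identification (eta P)),
      naturally_isomorphic (functor_comp E_functor P_functor) (functor_id RSBS) &
      equivalence_of_categories E_functor P_functor].
Proof.
have PE : naturally_isomorphic (functor_id PA) (functor_comp P_functor E_functor).
  by exists pg_proj_hom; apply: pg_proj_natural_iso.
have EP : naturally_isomorphic (functor_id RSBS) (functor_comp E_functor P_functor).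
  by exists boset_coord_hom; apply: boset_coord_natural_iso.
split; [|exact: naturally_isomorphic_sym|by split; exact: naturally_isomorphic_sym].
by exists pg_proj_hom; split; [exact: pg_proj_natural_iso|].
Qed.
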